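(* Let $M\ge 1$ be an integer, let $\theta_1,\dots,\theta_M$ be real with $|\theta_i|\le \pi$, let $a_1,\dots,a_M$ be complex numbers and $x_1,\dots,x_M$ nonzero complex numbers such that for all $i\ne j$ and all natural numbers $n,k\geq 1$ we have $x_i^2n^2-x_j^2k^2\neq a_j^2-a_i^2$, and such that for each $i\neq j$ either $\operatorname{Im}(x_i/x_j)\neq 0$ or $x_i=x_j$. Then for every complex $t$ with $t^2\neq a_i^2+x_i^2n^2$ for all $1\le i\le M$ and all $n\ge 1$, $$\sum_{i=1}^{M}\sum_{n=1}^{\infty}\frac{(-1)^{n-1}\cos(n\theta_i)}{x_i^2n^2+a_i^2-t^2}\prod_{\substack{1\le j\le M\\ j\ne i}}\left\{\frac{\pi}{2x_j\sqrt{x_i^2n^2+a_i^2-a_j^2}}\,\frac{\cos\left(\frac{\theta_j\sqrt{x_i^2n^2+a_i^2-a_j^2}}{x_j}\right)}{\sin\left(\frac{\pi\sqrt{x_i^2n^2+a_i^2-a_j^2}}{x_j}\right)}-\frac{1}{2(x_i^2n^2+a_i^2-a_j^2)}\right\}$$ $$=\prod_{i=1}^{M}\left\{\frac{\pi}{2x_i\sqrt{t^2-a_i^2}}\,\frac{\cos\left(\frac{\theta_i\sqrt{t^2-a_i^2}}{x_i}\right)}{\sin\left(\frac{\pi\sqrt{t^2-a_i^2}}{x_i}\right)}-\frac{1}{2(t^2-a_i^2)}\right\}.$$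
   Context: Each expression in braces has the form $\frac{\pi\cos(\theta z/x)}{2xz\sin(\pi z/x)}-\frac{1}{2z^2}$, which is even in $z$, so the choice of square root $z$ is irrelevant (the same one being used throughout the expression). It has a removable singularity at $z=0$, where it is understood as its limit. Empty products equal $1$. *)

(* Defs.v *)
(* Stdlib's real numbers with Coquelicot's complex numbers; finite index sets,
   sums and products over them come from MathComp's fintype and bigop. *)
From Stdlib Require Export Reals.
From Coquelicot Require Export Coquelicot.
From mathcomp Require Export ssreflect ssrbool eqtype ssrnat fintype bigop.

Open Scope R_scope.
Open Scope C_scope.

Definition Cexp (z : C) : C :=
  ((exp (Re z) * cos (Im z))%R, (exp (Re z) * sin (Im z))%R).

Definition Ccos (z : C) : C := (Cexp (Ci * z) + Cexp (- (Ci * z))) / 2.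

Definition Csin (z : C) : C := (Cexp (Ci * z) - Cexp (- (Ci * z))) / (2 * Ci).

Definition brace_expr (theta : R) (x z : C) : C :=
  PI / (2 * x * z) * (Ccos (theta * z / x) / Csin (PI * z / x))
    - 1 / (2 * z ^ 2).

(* [Cinv 0 = 0], so [brace_expr] has a junk value at its removable singularity
   [z = 0]; there it is replaced by its limit. *)
Definition brace (theta : R) (x z : C) : C :=
  if Ceq_dec z 0 then C_lim (brace_expr theta x) 0 else brace_expr theta x z.

(* The summand of index [n >= 1] of the [i]-th series. The function [sq] is a
   choice of complex square roots. *)
Definition term (M : nat) (sq : C -> C) (theta : 'I_M -> R) (a x : 'I_M -> C)
    (t : C) (i : 'I_M) (n : nat) : C :=
  (((-1) ^ (n - 1))%R * cos (INR n * theta i)%R)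
    / (x i ^ 2 * INR n ^ 2 + a i ^ 2 - t ^ 2)
  * \big[Cmult/RtoC 1]_(j < M | j != i)
      brace (theta j) (x j) (sq (x i ^ 2 * INR n ^ 2 + a i ^ 2 - a j ^ 2)).

(* Main.v *)
(* Up to scaling, the brace is a Mittag-Leffler series: brace theta x (sqrt u) is the sum over
   n >= 1 of (-1)^(n-1) cos (n theta) / (x^2 n^2 - u). This is the limit of a finite identity:
   for phi = pi z / N, the trapezoid sum over m = 0, ..., N of
   (-1)^m cos (m k pi / N) / (cos (m pi / N) - cos phi) satisfies in k the difference equation
   of cos (k phi), and it equals 2 N cos (k phi) / (sin (N phi) sin phi).

   With mu_(i,n) = x_i^2 n^2 + a_i^2 and T = t^2 the theorem then concerns the product of the
   series F_i(T) with terms c_(i,n) / (mu_(i,n) - T). For truncated series it is a partial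
   fraction decomposition. The hypothesis on Im (x_i / x_j) gives
   |mu_(j,m) - mu_(i,n)| >= c (1 + (m - n)^2) up to finitely many pairs (n, m), so that the
   truncations of F_j(mu_(i,n)) are bounded uniformly in n, and dominated convergence for
   series lets the truncation tend to infinity. *)

From HB Require Import structures.
Require Import Defs.
From Stdlib Require Import Lra Psatz.
From mathcomp Require Import ssrfun seq.
From mathcomp Require Import zify.

(** * Limits and series of complex numbers *)

(** The filter is arbitrary so that the same rules serve sequences and the punctured neighbourhood
    of [0] at the removable singularity. *)
Definition Clim {T : Type} (F : (T -> Prop) -> Prop) (f : T -> C) (l : C) : Prop :=
  forall eps : R, (0 < eps)%R -> F (fun t => (Cmod (f t - l) < eps)%R).

Lemma filter_imp2 {T : Type} {F : (T -> Prop) -> Prop} {FF : Filter F} (P Q S : T -> Prop) :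
  F P -> F Q -> (forall t, P t -> Q t -> S t) -> F S.
Proof.
move=> HP HQ H; apply filter_imp with (fun t => P t /\ Q t); last exact: filter_and.
by move=> t [? ?]; apply: H.
Qed.

Section ComplexLimits.
Context {T : Type} {F : (T -> Prop) -> Prop} {FF : Filter F}.

Lemma Clim_const (c : C) : Clim F (fun _ => c) c.
Proof.
move=> eps He; apply: filter_forall => t.
by rewrite (_ : c - c = 0) ?Cmod_0 //; ring.
Qed.

Lemma Clim_ext_loc (f g : T -> C) (l : C) :
  F (fun t => f t = g t) -> Clim F f l -> Clim F g l.
Proof.
move=> Hfg Hf eps He; refine (filter_imp2 _ _ _ Hfg (Hf _ He) _) => t ->.
by [].
Qed.

Lemma Clim_ext (f g : T -> C) (l : C) :
  (forall t, f t = g t) -> Clim F f l -> Clim F g l.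
Proof. by move=> H; apply: Clim_ext_loc; apply: filter_forall. Qed.

Lemma Clim_dominated (f : T -> C) (b : T -> R) (l : C) :
  F (fun t => (Cmod (f t - l) <= b t)%R) ->
  (forall eps : R, (0 < eps)%R -> F (fun t => (b t < eps)%R)) -> Clim F f l.
Proof.
move=> H1 H2 eps He; by refine (filter_imp2 _ _ _ H1 (H2 _ He) _) => t ? ?; lra.
Qed.

Lemma Clim_plus (f g : T -> C) (l m : C) :
  Clim F f l -> Clim F g m -> Clim F (fun t => f t + g t) (l + m).
Proof.
move=> Hf Hg eps He.
have He2 : (0 < eps / 2)%R by lra.
refine (filter_imp2 _ _ _ (Hf _ He2) (Hg _ He2) _) => t H1 H2.
rewrite (_ : f t + g t - (l + m) = (f t - l) + (g t - m)); last by ring.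
by apply: Rle_lt_trans (Cmod_triangle _ _) _; lra.
Qed.

Lemma Clim_mult (f g : T -> C) (l m : C) :
  Clim F f l -> Clim F g m -> Clim F (fun t => f t * g t) (l * m).
Proof.
move=> Hf Hg eps He.
have Hl := Cmod_ge_0 l; have Hm := Cmod_ge_0 m.
pose K := (Cmod l + Cmod m + 1)%R.
have HK : (0 < K)%R by rewrite /K; lra.
pose d := Rmin 1 (eps / K / 2).
have Hd : (0 < d)%R.
  by apply: Rmin_pos; first lra; apply: Rdiv_lt_0_compat; last lra; apply: Rdiv_lt_0_compat.
have Hd1 : (d <= 1)%R by apply: Rmin_l.
have Hd2 : (d * K < eps)%R.
  apply: (Rle_lt_trans _ (eps / K / 2 * K)).
    by apply: Rmult_le_compat_r; [lra | apply: Rmin_r].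
  by rewrite (_ : (eps / K / 2 * K)%R = (eps / 2)%R); [lra | field; lra].
refine (filter_imp2 _ _ _ (Hf _ Hd) (Hg _ Hd) _) => t H1 H2.
rewrite (_ : f t * g t - l * m = (f t - l) * (g t - m) + (f t - l) * m + l * (g t - m));
  last by ring.
apply: Rle_lt_trans (Cmod_triangle _ _) _.
apply: Rle_lt_trans (Rplus_le_compat_r _ _ _ (Cmod_triangle _ _)) _.
rewrite !Cmod_mult.
have H3 := Cmod_ge_0 (f t - l); have H4 := Cmod_ge_0 (g t - m).
rewrite /K in Hd2; nra.
Qed.

Lemma Clim_opp (f : T -> C) (l : C) : Clim F f l -> Clim F (fun t => - f t) (- l).
Proof.
move=> Hf eps He; refine (filter_imp _ _ _ (Hf _ He)) => t H.
by rewrite (_ : - f t - - l = - (f t - l)) ?Cmod_opp //; ring.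
Qed.

Lemma Clim_minus (f g : T -> C) (l m : C) :
  Clim F f l -> Clim F g m -> Clim F (fun t => f t - g t) (l - m).
Proof. by move=> Hf Hg; apply: Clim_plus => //; apply: Clim_opp. Qed.

Lemma Clim_away (f : T -> C) (l : C) :
  Clim F f l -> l <> 0 -> F (fun t => (Cmod l / 2 < Cmod (f t))%R).
Proof.
move=> Hf /Cmod_gt_0 Hl.
have H2 : (0 < Cmod l / 2)%R by lra.
refine (filter_imp _ _ _ (Hf _ H2)) => t H.
have := Cmod_triangle (f t) (- (f t - l)).
by rewrite Cmod_opp (_ : f t + - (f t - l) = l); [lra | ring].
Qed.

Lemma Clim_inv (f : T -> C) (l : C) :
  Clim F f l -> l <> 0 -> Clim F (fun t => / f t) (/ l).
Proof.
move=> Hf Hl eps He.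
have Hl' : (0 < Cmod l)%R by apply/Cmod_gt_0.
pose d := (eps * (Cmod l / 2 * Cmod l))%R.
have Hd : (0 < d)%R by rewrite /d; apply: Rmult_lt_0_compat => //; nra.
refine (filter_imp2 _ _ _ (Hf _ Hd) (Clim_away _ _ Hf Hl) _) => t H1 H2.
have H3 : f t <> 0 by apply/Cmod_gt_0; lra.
rewrite (_ : / f t - / l = - (f t - l) / (f t * l)); last by field.
rewrite Cmod_div; last by apply: Cmult_neq_0.
rewrite Cmod_opp Cmod_mult.
have H4 : (0 < Cmod (f t) * Cmod l)%R by nra.
apply: (Rmult_lt_reg_r _ _ _ H4).
rewrite /Rdiv Rmult_assoc Rinv_l; last lra.
rewrite Rmult_1_r; apply: Rlt_le_trans H1 _; rewrite /d.
apply: Rmult_le_compat_l; first lra.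
apply: Rmult_le_compat_r; lra.
Qed.

Lemma Clim_div (f g : T -> C) (l m : C) :
  Clim F f l -> Clim F g m -> m <> 0 -> Clim F (fun t => f t / g t) (l / m).
Proof. by move=> Hf Hg Hm; apply: Clim_mult => //; apply: Clim_inv. Qed.

Lemma Clim_sum_n (f : T -> nat -> C) (g : nat -> C) (N : nat) :
  (forall n, Clim F (fun t => f t n) (g n)) ->
  Clim F (fun t => sum_n (f t) N : C) (sum_n g N).
Proof.
move=> H; elim: N => [|N IH].
  rewrite sum_O; apply: (Clim_ext (fun t => f t 0%N)) => // t.
  by rewrite sum_O.
rewrite sum_Sn; apply: (Clim_ext (fun t => sum_n (f t) N + f t N.+1)); last exact: Clim_plus.
by move=> t; rewrite sum_Sn.
Qed.

End ComplexLimits.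

Lemma Clim_unique {T : Type} {F : (T -> Prop) -> Prop} {FF : ProperFilter F}
    (f : T -> C) (l m : C) : Clim F f l -> Clim F f m -> l = m.
Proof.
move=> Hl Hm; suff E : l - m = 0 by rewrite -(Cplus_0_l m) -E; ring.
apply: Cmod_eq_0.
apply: Rle_antisym; last exact: Cmod_ge_0.
apply: le_epsilon => eps He; rewrite Rplus_0_l.
have He2 : (0 < eps / 2)%R by lra.
case: (filter_ex _ (filter_and _ _ (Hl _ He2) (Hm _ He2))) => t [H1 H2].
rewrite (_ : l - m = - (f t - l) + (f t - m)); last by ring.
by apply: Rle_trans (Cmod_triangle _ _) _; rewrite Cmod_opp; lra.
Qed.

Lemma Clim_Cmod_le {T : Type} {F : (T -> Prop) -> Prop} {FF : ProperFilter F}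
    (f : T -> C) (l : C) (b : R) :
  Clim F f l -> F (fun t => (Cmod (f t) <= b)%R) -> (Cmod l <= b)%R.
Proof.
move=> Hl Hb; apply: le_epsilon => eps He.
case: (filter_ex _ (filter_and _ _ (Hl _ He) Hb)) => t [H1 H2].
have := Cmod_triangle (f t) (- (f t - l)).
by rewrite Cmod_opp (_ : f t + - (f t - l) = l); [lra | ring].
Qed.

Lemma Clim_filterlim {T : Type} {F : (T -> Prop) -> Prop} {FF : Filter F}
    (f : T -> C) (l : C) : filterlim f F (@locally C_NormedModule l) <-> Clim F f l.
Proof.
split=> H.
  move=> eps He.
  by have := H _ (@locally_ball_norm _ C_NormedModule l (mkposreal _ He)).
apply/filterlim_locally_ball_norm => eps.
exact: (H eps (cond_pos eps)).
Qed.

Lemma is_series_Clim (a : nat -> C) (l : C) :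
  is_series a l <-> Clim eventually (fun N => sum_n a N : C) l.
Proof. exact: Clim_filterlim. Qed.

(** The triangle inequality compares the blocks from [N + 1] to [N + k], and the bound survives the
    limit in [k]. *)
Lemma is_series_tail_le (a : nat -> C) (l : C) (h : nat -> R) (H : R) (N : nat) :
  is_series a l -> is_series h H -> (forall n, (Cmod (a n) <= h n)%R) ->
  (Cmod (l - sum_n a N) <= H - sum_n h N)%R.
Proof.
move=> Ha Hh Hle.
have h0 n : (0 <= h n)%R by apply: Rle_trans (Cmod_ge_0 _) (Hle n).
have part k : (Cmod (sum_n a (N + k) - sum_n a N) <= sum_n h (N + k) - sum_n h N)%R.
  elim: k => [|k IH].
    rewrite addn0 (_ : _ - _ = 0); last by rewrite /Cminus Cplus_opp_r.
    by rewrite Cmod_0; lra.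
  rewrite addnS !sum_Sn.
  rewrite (_ : plus (sum_n a (N + k)) (a (N + k).+1) - sum_n a N
    = (sum_n a (N + k) - sum_n a N) + a (N + k).+1); last first.
    by rewrite /plus /=; ring.
  apply: Rle_trans (Cmod_triangle _ _) _.
  have := Hle (N + k).+1; rewrite /plus /=; lra.
have incr : forall n, (sum_n h n <= H)%R.
  move=> n; apply: (is_lim_seq_incr_compare (sum_n h)); first exact: Hh.
  by move=> m; rewrite sum_Sn /plus /=; have := h0 m.+1; lra.
apply: (Clim_Cmod_le (F := eventually) (fun n => sum_n a n - sum_n a N)).
  apply: Clim_minus; [exact/is_series_Clim | exact: Clim_const].
exists N => n Hn; rewrite (_ : n = (N + (n - N))%N); last by lia.
apply: Rle_trans (part _) _.
have := incr (N + (n - N))%N; lra.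
Qed.

(** Dominated convergence for series along a filter. For a suitable [N] the tail of the majorant is
    below [eps / 3] and bounds both tails; the first terms form a finite sum, which converges
    termwise. *)
Lemma tannery {T : Type} {F : (T -> Prop) -> Prop} {FF : ProperFilter F}
    (f : T -> nat -> C) (g : nat -> C) (h : nat -> R) (S : T -> C) :
  (forall n, Clim F (fun t => f t n) (g n)) ->
  ex_series h ->
  F (fun t => forall n, (Cmod (f t n) <= h n)%R) ->
  F (fun t => is_series (f t) (S t)) ->
  exists l : C, is_series g l /\ Clim F S l.
Proof.
move=> Hfg exh Hdom HS; have Hh := Series_correct _ exh.
have gh n : (Cmod (g n) <= h n)%R.
  by apply: (Clim_Cmod_le _ _ _ (Hfg n)); refine (filter_imp _ _ _ Hdom) => t.
have [l Hl] : exists l : C, is_series g l.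
  by apply: (ex_series_le _ h); [exact: gh |].
exists l; split=> // eps He.
have He3 : (0 < eps / 3)%R by lra.
have [N HN] : exists N, (Series h - sum_n h N < eps / 3)%R.
  have [N /(_ N (le_n _)) HN] := proj1 (filterlim_locally _ _) Hh (mkposreal _ He3).
  exists N; change (Rabs (sum_n h N - Series h) < eps / 3)%R in HN.
  by move/Rabs_def2: HN => [_ ?]; lra.
refine (filter_imp2 _ _ _ (filter_and _ _ Hdom HS) (Clim_sum_n _ _ N Hfg _ He3) _) => t [H1 H2] H3.
have H4 := is_series_tail_le _ _ _ _ N H2 Hh H1.
have H5 := is_series_tail_le _ _ _ _ N Hl Hh gh.
rewrite (_ : S t - l = (S t - sum_n (f t) N) + ((sum_n (f t) N - sum_n g N) + - (l - sum_n g N)));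
  last by ring.
apply: Rle_lt_trans (Cmod_triangle _ _) _.
have := Cmod_triangle (sum_n (f t) N - sum_n g N) (- (l - sum_n g N)).
rewrite Cmod_opp; lra.
Qed.

(** * Sums and products of complex numbers as big operators *)

HB.instance Definition _ := Monoid.isComLaw.Build C (RtoC 0) Cplus Cplus_assoc Cplus_comm Cplus_0_l.
HB.instance Definition _ := Monoid.isComLaw.Build C (RtoC 1) Cmult Cmult_assoc Cmult_comm Cmult_1_l.
HB.instance Definition _ := Monoid.isMulLaw.Build C (RtoC 0) Cmult Cmult_0_l Cmult_0_r.
HB.instance Definition _ := Monoid.isAddLaw.Build C Cmult Cplus
  (fun x y z => Cmult_plus_distr_r x y z) (fun x y z => Cmult_plus_distr_l x y z).

Lemma sum_n_big (a : nat -> C) (N : nat) :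
  sum_n a N = \big[Cplus/RtoC 0]_(0 <= n < N.+1) a n.
Proof.
elim: N => [|N IH]; first by rewrite sum_O big_nat1.
by rewrite sum_Sn IH [RHS]big_nat_recr.
Qed.

Lemma is_series_finite (a : nat -> C) (N : nat) :
  is_series (fun n => if (n < N)%N then a n else 0) (\big[Cplus/RtoC 0]_(0 <= n < N) a n).
Proof.
apply/is_series_Clim; apply: (Clim_ext_loc (fun _ => \big[Cplus/RtoC 0]_(0 <= n < N) a n));
  last exact: Clim_const.
exists N => k /leP Hk; rewrite sum_n_big [RHS](big_cat_nat (n := N)) //=; last exact: leqW.
rewrite [X in _ = _ + X]big1_seq ?Cplus_0_r.
  by apply: eq_big_nat => n /andP [_ ->].
by move=> n /=; rewrite mem_index_iota => /andP [HN _]; rewrite ltnNge HN.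
Qed.

Lemma is_series_C_scal (c : C) (a : nat -> C) (l : C) :
  is_series a l -> is_series (fun n => c * a n) (c * l).
Proof. exact: (is_series_scal (V := C_NormedModule) c). Qed.

Lemma is_series_C_ext (a b : nat -> C) (l m : C) :
  (forall n, a n = b n) -> l = m -> is_series a l -> is_series b m.
Proof. by move=> H <-; apply: is_series_ext. Qed.

(** * Separation of the poles *)

HB.instance Definition _ := Monoid.isComLaw.Build R 0%R Rplus
  (fun x y z => esym (Rplus_assoc x y z)) Rplus_comm Rplus_0_l.

Lemma sum_n_big_R (a : nat -> R) (N : nat) :
  sum_n a N = \big[Rplus/0%R]_(0 <= n < N.+1) a n.
Proof.
elim: N => [|N IH]; first by rewrite sum_O big_nat1.
by rewrite sum_Sn IH [RHS]big_nat_recr.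
Qed.

Lemma sum_R_le (N : nat) (a b : nat -> R) :
  (forall n, (a n <= b n)%R) ->
  (\big[Rplus/0%R]_(0 <= n < N) a n <= \big[Rplus/0%R]_(0 <= n < N) b n)%R.
Proof.
move=> H; apply: (big_ind2 (fun x y => (x <= y)%R)) => //; first lra.
by move=> *; lra.
Qed.

Lemma sum_R_mult_l (N : nat) (c : R) (a : nat -> R) :
  (\big[Rplus/0%R]_(0 <= n < N) (c * a n))%R = (c * \big[Rplus/0%R]_(0 <= n < N) a n)%R.
Proof.
apply: esym; apply: (big_morph (fun x => (c * x)%R)); last by rewrite Rmult_0_r.
by move=> *; rewrite Rmult_plus_distr_l.
Qed.

Lemma Cmod_sum_le (N : nat) (a : nat -> C) :
  (Cmod (\big[Cplus/RtoC 0]_(0 <= n < N) a n) <= \big[Rplus/0%R]_(0 <= n < N) Cmod (a n))%R.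
Proof.
apply: (big_ind2 (fun x y => (Cmod x <= y)%R)); first by rewrite Cmod_0; lra.
  by move=> x x' y y' H1 H2; apply: Rle_trans (Cmod_triangle _ _) _; lra.
by move=> *; lra.
Qed.

(** The summable majorant of every domination argument below; unlike [1 / t^2] it is finite at
    [t = 0]. *)
Definition quad_decay (t : R) : R := (/ (1 + t ^ 2))%R.

Lemma quad_decay_pos (t : R) : (0 < quad_decay t)%R.
Proof. by apply: Rinv_0_lt_compat; nra. Qed.

(** Telescoping: for [p >= 1], [1 / (1 + p^2) <= 2 / p - 2 / (p + 1)], because
    [p (p + 1) / 2 <= 1 + p^2]. *)
Lemma sum_quad_decay_le (N : nat) :
  (\big[Rplus/0%R]_(0 <= n < N.+1) quad_decay (INR n) <= 3 - 2 * / INR N.+1)%R.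
Proof.
elim: N => [|N IH]; first by rewrite big_nat1 /quad_decay /=; lra.
rewrite big_nat_recr //=; set s := bigop _ _ _ in IH *.
have E : (quad_decay (INR N.+1) <= 2 * / INR N.+1 - 2 * / INR N.+2)%R.
  rewrite /quad_decay (S_INR N.+1).
  have H : (1 <= INR N.+1)%R by rewrite S_INR; have := pos_INR N; lra.
  rewrite (_ : (_ - _)%R = (/ ((INR N.+1 * (INR N.+1 + 1)) / 2))%R); last by field; lra.
  by apply: Rinv_le_contravar; nra.
rewrite /= in E IH *; lra.
Qed.

Lemma sum_quad_decay_le3 (N : nat) :
  (\big[Rplus/0%R]_(0 <= n < N) quad_decay (INR n) <= 3)%R.
Proof.
case: N => [|N]; first by rewrite big_geq //; lra.
apply: Rle_trans (sum_quad_decay_le N) _.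
have := Rinv_0_lt_compat _ (lt_0_INR _ (PeanoNat.Nat.lt_0_succ N)); lra.
Qed.

Lemma ex_series_quad_decay : ex_series (fun n => quad_decay (INR n)).
Proof.
apply: (ex_finite_lim_seq_incr _ 3) => n.
  by rewrite sum_Sn /plus /=; have := quad_decay_pos (INR n.+1); rewrite /=; lra.
by rewrite sum_n_big_R; apply: sum_quad_decay_le3.
Qed.

(** The indices below and above [n] contribute a one-sided sum each, and such a sum is at most [3].
    What matters is that the bound is uniform in [n]. *)
Lemma sum_quad_decay_shift_le6 (n N : nat) :
  (\big[Rplus/0%R]_(0 <= m < N) quad_decay (INR m - INR n) <= 6)%R.
Proof.
suff : (\big[Rplus/0%R]_(0 <= m < N) quad_decay (INR m - INR n)
   <= \big[Rplus/0%R]_(0 <= m < n.+1) quad_decay (INR m)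
      + \big[Rplus/0%R]_(0 <= m < N) quad_decay (INR m))%R.
  by have := sum_quad_decay_le3 n.+1; have := sum_quad_decay_le3 N; lra.
elim: n N => [|n IH] N.
  rewrite big_nat1; have := quad_decay_pos (INR 0).
  under [X in (X <= _)%R]eq_bigr => m _ do rewrite Rminus_0_r.
  by lra.
have pos k : (0 <= \big[Rplus/0%R]_(0 <= m < k) quad_decay (INR m))%R.
  apply: (big_ind (fun x => (0 <= x)%R)); [lra | by move=> *; lra |].
  by move=> m _; apply/Rlt_le/quad_decay_pos.
case: N => [|N].
  by rewrite big_geq //; have := pos n.+2; have := pos 0%N; lra.
rewrite big_nat_recl // [X in (_ <= X + _)%R]big_nat_recr // [X in (_ <= _ + X)%R]big_nat_recr //.
rewrite (_ : quad_decay (INR 0 - INR n.+1) = quad_decay (INR n.+1)); last first.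
  by rewrite /quad_decay; congr (/ (1 + _))%R; rewrite /=; ring.
under [X in (_ + X <= _)%R]eq_bigr => m _.
  rewrite (_ : (INR m.+1 - INR n.+1)%R = (INR m - INR n)%R); last by rewrite !S_INR; ring.
over.
have := IH N; have := quad_decay_pos (INR N); have := quad_decay_pos (INR n.+1).
move=> /=; lra.
Qed.

(** Serves to absorb into a constant the finitely many indices that an asymptotic estimate leaves
    out. *)
Lemma bounded_below_index (f : nat -> R) (N : nat) :
  exists B : R, (0 <= B)%R /\ forall n, (n < N)%N -> (f n <= B)%R.
Proof.
elim: N => [|N [B [HB H]]]; first by exists 0%R; split; [lra |].
exists (Rmax B (f N)); split; first by apply: Rle_trans (Rmax_l _ _).
move=> n; rewrite ltnS leq_eqVlt => /orP [/eqP -> | Hn]; first exact: Rmax_r.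
by apply: Rle_trans (Rmax_l _ _); apply: H.
Qed.

Lemma bounded_below_index2 (f : nat -> nat -> R) (N : nat) :
  exists B : R, (0 <= B)%R /\ forall n m, (n < N)%N -> (m < N)%N -> (f n m <= B)%R.
Proof.
suff H k : exists B : R, (0 <= B)%R /\ forall n m, (n < k)%N -> (m < N)%N -> (f n m <= B)%R
  by exact: H.
elim: k => [|k [B [HB H]]]; first by exists 0%R; split; [lra |].
have [B' [HB' H']] := bounded_below_index (f k) N.
exists (Rmax B B'); split; first by apply: Rle_trans (Rmax_l _ _).
move=> n m; rewrite ltnS leq_eqVlt => /orP [/eqP -> | Hn] Hm.
  by apply: Rle_trans (Rmax_r _ _); apply: H'.
by apply: Rle_trans (Rmax_l _ _); apply: H.
Qed.

Lemma Cmod_inv_le_quad_decay (w : C) (c t : R) :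
  (0 < c)%R -> (c * (1 + t ^ 2) <= Cmod w)%R -> (Cmod (/ w) <= / c * quad_decay t)%R.
Proof.
move=> Hc H; have Ht : (0 < 1 + t ^ 2)%R by nra.
have Hct : (0 < c * (1 + t ^ 2))%R by apply: Rmult_lt_0_compat.
rewrite Cmod_inv; last by apply/Cmod_gt_0; lra.
by rewrite /quad_decay -Rinv_mult; apply: Rinv_le_contravar.
Qed.

Lemma INR_large (r : R) : exists N : nat, forall n, (N <= n)%N -> (r <= INR n)%R.
Proof.
have [N HN] := nfloor_ex (Rmax 0 r) (Rmax_l _ _).
exists N.+1 => n Hn; apply: (Rle_trans _ (INR N.+1)).
  by rewrite S_INR; have := Rmax_r 0 r; lra.
exact/le_INR/leP.
Qed.

Lemma shifted_square_inv_bound (x b : C) :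
  x <> 0 ->
  exists B : R, (0 <= B)%R /\
    forall n : nat, (Cmod (/ (x ^ 2 * INR n.+1 ^ 2 + b)) <= B * quad_decay (INR n))%R.
Proof.
move=> /Cmod_gt_0 Hx; pose c := (Cmod x ^ 2)%R.
have Hc : (0 < c)%R by apply: pow_lt.
(* From this index on [Cmod b <= c n / 2], so the denominator has modulus at least
   [c (n + 1)^2 - c n / 2 >= c (1 + n^2) / 2]. *)
have [N HN] := INR_large (2 * Cmod b / c).
have [B [HB Hsmall]] := bounded_below_index
  (fun n => (Cmod (/ (x ^ 2 * INR n.+1 ^ 2 + b)) / quad_decay (INR n))%R) N.
have Hc2 : (0 < / (c / 2))%R by apply: Rinv_0_lt_compat; lra.
exists (Rmax B (/ (c / 2))); split; first by apply: Rle_trans (Rmax_l _ _).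
move=> n; have Hq := quad_decay_pos (INR n).
case: (ltnP n N) => Hn.
  apply: (Rle_trans _ (B * quad_decay (INR n))); last first.
    by apply: Rmult_le_compat_r; [lra | apply: Rmax_l].
  apply: (Rmult_le_reg_r (/ quad_decay (INR n))); first exact: Rinv_0_lt_compat.
  by rewrite Rmult_assoc Rinv_r; [rewrite Rmult_1_r; apply: Hsmall | lra].
apply: (Rle_trans _ (/ (c / 2) * quad_decay (INR n))); last first.
  by apply: Rmult_le_compat_r; [lra | apply: Rmax_r].
apply: Cmod_inv_le_quad_decay; first lra.
have Hb : (Cmod b <= c / 2 * INR n)%R.
  rewrite (_ : Cmod b = (c / 2 * (2 * Cmod b / c))%R); last by field; lra.
  by apply: Rmult_le_compat_l; [lra | apply: HN].
have := Cmod_triangle (x ^ 2 * INR n.+1 ^ 2 + b) (- b).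
rewrite Cmod_opp (_ : x ^ 2 * INR n.+1 ^ 2 + b + - b = x ^ 2 * INR n.+1 ^ 2); last by ring.
rewrite Cmod_mult !Cmod_pow Cmod_R Rabs_pos_eq; last exact: pos_INR.
rewrite -/c S_INR; have := pos_INR n; nra.
Qed.

(** Outside the square [n, m < N] each term is dominated by a shifted [quad_decay], whose sum over
    [m] is at most [6] for every [n]. The square holds finitely many terms, which only enlarge the
    constant. *)
Lemma sep_inv_bound (D : nat -> nat -> C) (c : R) (N : nat) :
  (0 < c)%R ->
  (forall n m, (N <= n)%N || (N <= m)%N ->
     (c * (1 + (INR m - INR n) ^ 2) <= Cmod (D n m))%R) ->
  exists K : R, (0 <= K)%R /\
    forall n M, (\big[Rplus/0%R]_(0 <= m < M) Cmod (/ D n m) <= K)%R.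
Proof.
move=> Hc Hlarge.
have [B [HB Hsmall]] := bounded_below_index2
  (fun n m => (Cmod (/ D n m) / quad_decay (INR m - INR n))%R) N.
have Hic : (0 < / c)%R by apply: Rinv_0_lt_compat.
exists (6 * Rmax B (/ c))%R; have HM := Rmax_l B (/ c); split; first lra.
move=> n M; apply: (Rle_trans _ (\big[Rplus/0%R]_(0 <= m < M) (Rmax B (/ c) * quad_decay (INR m - INR n)))%R).
  apply: sum_R_le => m; have Hq := quad_decay_pos (INR m - INR n).
  case: (boolP ((N <= n)%N || (N <= m)%N)) => [H | ].
    apply: (Rle_trans _ (/ c * quad_decay (INR m - INR n))); last first.
      by apply: Rmult_le_compat_r; [lra | apply: Rmax_r].
    by apply: Cmod_inv_le_quad_decay => //; apply: Hlarge.
  rewrite negb_or -!ltnNge => /andP [Hn Hm].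
  apply: (Rle_trans _ (B * quad_decay (INR m - INR n))); last first.
    by apply: Rmult_le_compat_r; [lra | apply: Rmax_l].
  apply: (Rmult_le_reg_r (/ quad_decay (INR m - INR n))); first exact: Rinv_0_lt_compat.
  by rewrite Rmult_assoc Rinv_r; [rewrite Rmult_1_r; apply: Hsmall | lra].
rewrite sum_R_mult_l Rmult_comm; apply: Rmult_le_compat_r; first lra.
exact: sum_quad_decay_shift_le6.
Qed.

(** * Lower bounds for differences of squares *)

Lemma Cmod_INR (n : nat) : Cmod (INR n) = INR n.
Proof. by rewrite Cmod_R Rabs_pos_eq //; apply: pos_INR. Qed.

(* For real [s] and [t], both [Im ((s - q t) * Cconj q)] and [Im (s - q t)] are, up to
   sign, [Im q] times [s], respectively [t]. *)
Lemma Cmod_sub_mul_real_ge (q : C) (s t : R) :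
  (Rabs (s * Im q) <= Cmod q * Cmod (s - q * t))%R /\
  (Rabs (t * Im q) <= Cmod (s - q * t))%R.
Proof.
split.
  have := re_le_Cmod (Ci * ((s - q * t) * Cconj q)).
  rewrite !Cmod_mult Cmod_conj Cmod_Ci => H;
    apply: Rle_trans (_ : (_ <= 1 * (Cmod (s - q * t) * Cmod q))%R) _.
    apply: Rle_trans H; apply: Req_le; congr Rabs.
    by case: q => a b; rewrite /=; ring.
  by rewrite Rmult_1_l Rmult_comm; lra.
have := re_le_Cmod (Ci * (s - q * t)).
rewrite Cmod_mult Cmod_Ci Rmult_1_l; apply: Rle_trans; apply: Req_le; congr Rabs.
by case: q => a b; rewrite /=; ring.
Qed.

(** Factor [s^2 - q^2 t^2 = (s - q t) (s + q t)]. Each factor is at least [e |s|] and at least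
    [|Im q| |t|] in modulus, so the product bounds both squares, hence half of their sum. *)
Lemma Cmod_sub_sq_real_ge (q : C) : Im q <> 0%R ->
  exists c : R, (0 < c)%R /\ forall s t : R,
    (c * (s ^ 2 + t ^ 2) <= Cmod (s ^ 2 - q ^ 2 * t ^ 2))%R.
Proof.
move=> Hq.
have Hi : (0 < Rabs (Im q))%R by apply: Rabs_pos_lt.
have Hq0 : (0 < Cmod q)%R.
  by apply/Cmod_gt_0 => E; apply: Hq; rewrite E.
pose e := (Rabs (Im q) / Cmod q)%R.
have He : (0 < e)%R by apply: Rdiv_lt_0_compat.
exists (Rmin (e ^ 2) (Rabs (Im q) ^ 2) / 2)%R; split.
  by apply: Rdiv_lt_0_compat; last lra; apply: Rmin_pos; apply: pow_lt.
move=> s t; rewrite (_ : s ^ 2 - q ^ 2 * t ^ 2 = (s - q * t) * (s - (- q) * t)); last by ring.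
rewrite Cmod_mult.
have [A1 A2] := Cmod_sub_mul_real_ge q s t.
have [B1 B2] := Cmod_sub_mul_real_ge (- q) s t.
have Iq : Rabs (Im (- q)) = Rabs (Im q)
  by rewrite -Rabs_Ropp; congr Rabs; case: (q) => a b /=; ring.
move: A1 A2 B1 B2; rewrite !Rabs_mult Cmod_opp Iq.
set X := Cmod (s - _); set Y := Cmod (s - _) => A1 A2 B1 B2.
have X1 : (Rabs s * e <= X)%R.
  apply: (Rmult_le_reg_l (Cmod q)) => //; apply: Rle_trans A1; apply: Req_le.
  by rewrite /e; field; lra.
have Y1 : (Rabs s * e <= Y)%R.
  apply: (Rmult_le_reg_l (Cmod q)) => //; apply: Rle_trans B1; apply: Req_le.
  by rewrite /e; field; lra.
have Hs := Rabs_pos s; have Ht := Rabs_pos t.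
have Z1 : ((Rabs s * e) * (Rabs s * e) <= X * Y)%R by apply: Rmult_le_compat => //; nra.
have Z2 : ((Rabs t * Rabs (Im q)) * (Rabs t * Rabs (Im q)) <= X * Y)%R
  by apply: Rmult_le_compat => //; nra.
have M1 := Rmin_l (e ^ 2) (Rabs (Im q) ^ 2).
have M2 := Rmin_r (e ^ 2) (Rabs (Im q) ^ 2).
have S2 := pow2_abs s; have T2 := pow2_abs t.
set m := Rmin _ _ in M1 M2 *.
have W1 : (m * s ^ 2 <= e ^ 2 * s ^ 2)%R by apply: Rmult_le_compat_r; [nra|].
have W2 : (m * t ^ 2 <= Rabs (Im q) ^ 2 * t ^ 2)%R by apply: Rmult_le_compat_r; [nra|].
have V1 : ((Rabs s * e) * (Rabs s * e) = e ^ 2 * s ^ 2)%R by rewrite -S2; ring.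
have V2 : ((Rabs t * Rabs (Im q)) * (Rabs t * Rabs (Im q)) = Rabs (Im q) ^ 2 * t ^ 2)%R
  by rewrite -T2; ring.
lra.
Qed.

(** If [q = x / y] is not real, the difference grows like [m^2 + n^2] and outweighs [d]. If [x = y],
    it is [y^2 (m - n) (m + n + 2) - d]: off the diagonal the product outweighs [d], and on the
    diagonal only [- d] remains, whence the condition [d <> 0]. *)
Lemma shifted_squares_separated (x y d : C) :
  y <> 0 -> Im (x / y) <> 0%R \/ x = y /\ d <> 0 ->
  exists (c : R) (N : nat), (0 < c)%R /\ forall n m : nat, (N <= n)%N || (N <= m)%N ->
    (c * (1 + (INR m - INR n) ^ 2)
      <= Cmod (y ^ 2 * INR m.+1 ^ 2 - (x ^ 2 * INR n.+1 ^ 2 + d)))%R.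
Proof.
move=> Hy Hxy; pose q := x / y.
have Hy0 : (0 < Cmod y)%R by apply/Cmod_gt_0.
have Hy' : (0 < Cmod y ^ 2)%R by apply: pow_lt.
have Hd := Cmod_ge_0 d.
have lower n m : (Cmod y ^ 2 * Cmod (INR m.+1 ^ 2 - q ^ 2 * INR n.+1 ^ 2) - Cmod d
    <= Cmod (y ^ 2 * INR m.+1 ^ 2 - (x ^ 2 * INR n.+1 ^ 2 + d)))%R.
  have := Cmod_triangle (y ^ 2 * INR m.+1 ^ 2 - (x ^ 2 * INR n.+1 ^ 2 + d)) d.
  rewrite (_ : _ + d = y ^ 2 * (INR m.+1 ^ 2 - q ^ 2 * INR n.+1 ^ 2)); last by rewrite /q; field.
  by rewrite Cmod_mult Cmod_pow; lra.
case: Hxy => [Hq | [E Hd0]].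
  have [c [Hc Hcq]] := Cmod_sub_sq_real_ge q Hq.
  (* Half of the quadratic growth is spent on absorbing [d]. *)
  pose c' := (Cmod y ^ 2 * c / 2)%R.
  have Hc' : (0 < c')%R by rewrite /c'; nra.
  have [N HN] := INR_large (Cmod d / c').
  exists c', N; split=> // n m Hnm; apply: Rle_trans (lower n m).
  have L : (Cmod d <= c' * (INR m.+1 ^ 2 + INR n.+1 ^ 2))%R.
    rewrite (_ : Cmod d = (c' * (Cmod d / c'))%R); last by field; lra.
    apply: Rmult_le_compat_l; first lra.
    rewrite !S_INR; have := pos_INR n; have := pos_INR m.
    by case/orP: Hnm => /HN; nra.
  have P := Rmult_le_compat_l _ _ _ (Rlt_le _ _ Hy') (Hcq (INR m.+1) (INR n.+1)).
  have Q : (c' * (1 + (INR m - INR n) ^ 2) <= c' * (INR m.+1 ^ 2 + INR n.+1 ^ 2))%R.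
    apply: Rmult_le_compat_l; first lra.
    by rewrite !S_INR; have := pos_INR n; have := pos_INR m; nra.
  by rewrite -!RtoC_pow in P *; rewrite /c' in L Q *; lra.
have Hd1 : (0 < Cmod d)%R by apply/Cmod_gt_0.
(* The bound [Cmod d] serves the diagonal [n = m]. Off it, half of [Cmod y ^ 2 * (a * b)] absorbs
   [d], and [1 + a^2 <= 2 a b] turns the rest into [Cmod y ^ 2 / 4 * (1 + a^2)]. *)
pose c := Rmin (Cmod y ^ 2 / 4) (Cmod d).
have Hc : (0 < c)%R by apply: Rmin_pos; lra.
have [N HN] := INR_large (Cmod d / (Cmod y ^ 2 / 2)).
exists c, N; split=> // n m Hnm.
case: (eqVneq n m) => [-> | neq].
  rewrite E (_ : _ - _ = - d); last by ring.
  rewrite Cmod_opp (_ : (_ * _)%R = c); last by ring.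
  exact: Rmin_r.
apply: Rle_trans (lower n m).
rewrite /q E (_ : y / y = 1); last by field.
rewrite (_ : INR m.+1 ^ 2 - 1 ^ 2 * INR n.+1 ^ 2 = ((INR m - INR n) * (INR m + INR n + 2))%R);
  last first.
  by rewrite !S_INR -!RtoC_pow /= !(RtoC_mult, RtoC_plus, RtoC_minus); ring.
rewrite Cmod_R Rabs_mult (Rabs_pos_eq (_ + 2)); last by have := pos_INR n; have := pos_INR m; lra.
have D1 : (1 <= Rabs (INR m - INR n))%R.
  case: (ltngtP n m) neq => // /ltP /le_INR; rewrite S_INR => H _.
    by rewrite Rabs_pos_eq; lra.
  by rewrite Rabs_left; lra.
have D2 : (Rabs (INR m - INR n) <= INR m + INR n + 2)%R.
  by have := pos_INR n; have := pos_INR m => ? ?; apply: Rabs_le; lra.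
have D3 := pow2_abs (INR m - INR n).
set a := Rabs _ in D1 D2 D3 *; set b := (_ + _ + 2)%R in D2 *.
have ab1 : (1 + a ^ 2 <= 2 * (a * b))%R by nra.
have ab2 : (Cmod d <= Cmod y ^ 2 / 2 * (a * b))%R.
  rewrite (_ : Cmod d = (Cmod y ^ 2 / 2 * (Cmod d / (Cmod y ^ 2 / 2)))%R); last by field; lra.
  apply: Rmult_le_compat_l; first lra.
  have : (Cmod d / (Cmod y ^ 2 / 2) <= b)%R.
    by have := pos_INR n; have := pos_INR m; rewrite /b; case/orP: Hnm => /HN; lra.
  have : (1 * b <= a * b)%R by apply: Rmult_le_compat_r => //; lra.
  by lra.
have c1 : (c <= Cmod y ^ 2 / 4)%R by apply: Rmin_l.
rewrite -D3.
have : (c * (1 + a ^ 2) <= Cmod y ^ 2 / 4 * (2 * (a * b)))%R by apply: Rmult_le_compat; nra.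
by lra.
Qed.

(** * The finite identity *)

Lemma Cexp_0 : Cexp 0 = 1.
Proof. by rewrite /Cexp /= exp_0 cos_0 sin_0 Rmult_1_l Rmult_0_r. Qed.

Lemma Cexp_plus (z w : C) : Cexp (z + w) = Cexp z * Cexp w.
Proof.
case: z w => [a b] [c d].
by rewrite /Cexp /Cmult /= exp_plus cos_plus sin_plus; congr (_, _); ring.
Qed.

Lemma C2_neq0 : RtoC 2 <> 0.
Proof. by move/RtoC_inj; lra. Qed.

Lemma Ci_neq0 : Ci <> 0.
Proof. by move/(f_equal Im) => /=; lra. Qed.

Lemma Ci_sqr : Ci * Ci = - (1).
Proof. by rewrite /Ci /Cmult /= /Copp /=; congr (_, _); ring. Qed.

Lemma Ccos_RtoC (a : R) : Ccos a = cos a.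
Proof.
have := C2_neq0; rewrite /Ccos /Cexp /= => H.
rewrite !(Rmult_0_l, Rmult_1_l, Rminus_0_r, Rmult_0_r, Rplus_0_l, Rplus_0_r, Ropp_0, Rminus_0_l, exp_0) cos_neg sin_neg.
by rewrite /Cplus /Cdiv /Cmult /Cinv /=; congr (_, _); field.
Qed.

Lemma Ccos_opp (z : C) : Ccos (- z) = Ccos z.
Proof.
have E : Ci * - z = - (Ci * z) by ring.
have E' : - - (Ci * z) = Ci * z by ring.
by rewrite /Ccos E E' [Cexp _ + _]Cplus_comm.
Qed.

Lemma Csin_opp (z : C) : Csin (- z) = - Csin z.
Proof.
have E : Ci * - z = - (Ci * z) by ring.
have E' : - - (Ci * z) = Ci * z by ring.
rewrite /Csin E E'; set a := Cexp _; set b := Cexp _.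
by rewrite /Cdiv; ring.
Qed.

Lemma Ccos_plus (z w : C) : Ccos (z + w) = Ccos z * Ccos w - Csin z * Csin w.
Proof.
have Hi := Ci_neq0; have H2 := C2_neq0.
rewrite /Ccos /Csin (_ : - (Ci * (z + w)) = - (Ci * z) + - (Ci * w)); last by ring.
rewrite (_ : Ci * (z + w) = Ci * z + Ci * w); last by ring.
rewrite !Cexp_plus; set a := Cexp _; set b := Cexp _; set c := Cexp _; set d := Cexp _.
have -> : (a - c) / (2 * Ci) * ((b - d) / (2 * Ci)) = - ((a - c) * (b - d) / (2 * 2)).
  rewrite (_ : _ * _ = (a - c) * (b - d) / (2 * 2 * (Ci * Ci))); last by field.
  by rewrite Ci_sqr; field.
by field.
Qed.

Lemma Ccos_minus (z w : C) : Ccos (z - w) = Ccos z * Ccos w + Csin z * Csin w.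
Proof. by rewrite /Cminus Ccos_plus Ccos_opp Csin_opp; ring. Qed.

Lemma Ccos_half_angle (z : C) : 1 - Ccos z = 2 * (Csin (z / 2) * Csin (z / 2)).
Proof.
have H2 := C2_neq0.
rewrite {1}(_ : z = z / 2 + z / 2); last by field.
have := Ccos_minus (z / 2) (z / 2).
rewrite /Cminus Cplus_opp_r Ccos_RtoC cos_0 Ccos_plus => ->; ring.
Qed.

(** Twice the trapezoid rule on the nodes [0, ..., n + 1]: the two end nodes have weight [1], the
    inner ones weight [2]. The number of steps is [N = n + 1], so it is never zero. *)
Definition trapezoid (n : nat) (u : nat -> C) : C :=
  u 0%N + 2 * (\big[Cplus/RtoC 0]_(0 <= m < n) u m.+1) + u n.+1.

Lemma trapezoidS (n : nat) (u : nat -> C) :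
  trapezoid n.+1 u = trapezoid n u + u n.+1 + u n.+2.
Proof. by rewrite /trapezoid big_nat_recr //=; ring. Qed.

Lemma trapezoid_linear (n : nat) (a b : C) (u v w : nat -> C) :
  (forall m, (m <= n.+1)%N -> w m = a * u m + b * v m) ->
  trapezoid n w = a * trapezoid n u + b * trapezoid n v.
Proof.
elim: n => [|n IH] H.
  by rewrite /trapezoid !big_geq // !H //; ring.
rewrite !trapezoidS IH; last by move=> m Hm; apply: H; apply: leqW.
by rewrite !H //; ring.
Qed.

(** One step adds [2 (-1)^(n+1) sin g sin (b/2)] with the midpoint [g = (n + 3/2) b], and
    [2 sin g cos (b/2)] is the sum of the sines of two consecutive multiples of [b], so the
    alternating signs telescope. *)
Lemma trapezoid_alt_cos (n : nat) (b : R) :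
  cos (b / 2) * trapezoid n (fun m => ((-1) ^ m * cos (INR m * b))%R)
    = ((-1) ^ n * sin (INR n.+1 * b) * sin (b / 2))%R.
Proof.
elim: n => [|n IH].
  rewrite /trapezoid big_geq //= -RtoC_mult Rmult_0_l cos_0 -!RtoC_plus -RtoC_mult.
  congr RtoC; rewrite !Rmult_1_l; set h := (b / 2)%R.
  rewrite (_ : b = h + h)%R; last by rewrite /h; field.
  rewrite cos_plus sin_plus; have := sin2_cos2 h; rewrite /Rsqr => E.
  transitivity (cos h * (sin h * sin h + cos h * cos h - (cos h * cos h - sin h * sin h)))%R.
    by rewrite E; ring.
  by ring.
rewrite trapezoidS 2!Cmult_plus_distr_l IH -!RtoC_mult -!RtoC_plus; congr RtoC.
pose g := ((INR n.+1 + / 2) * b)%R.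
rewrite (_ : (INR n.+1 * b)%R = (g - b / 2)%R); last by rewrite /g; field.
rewrite (_ : (INR n.+2 * b)%R = (g + b / 2)%R); last by rewrite /g (S_INR n.+1); field.
rewrite cos_plus cos_minus sin_plus sin_minus /=; ring.
Qed.

Lemma cos_mult_PI (m : nat) : cos (INR m * PI) = ((-1) ^ m)%R.
Proof.
elim: m => [|m IH]; first by rewrite Rmult_0_l cos_0.
by rewrite S_INR Rmult_plus_distr_r Rmult_1_l neg_cos IH /=; ring.
Qed.

Lemma sin_mult_PI (m : nat) : sin (INR m * PI) = 0%R.
Proof.
elim: m => [|m IH]; first by rewrite Rmult_0_l sin_0.
by rewrite S_INR Rmult_plus_distr_r Rmult_1_l neg_sin IH; ring.
Qed.

Lemma alt_sq (m : nat) : ((-1) ^ m * (-1) ^ m = 1)%R.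
Proof. by rewrite -Rpow_mult_distr (_ : (-1 * -1)%R = 1%R) ?pow1 //; ring. Qed.

(** Discrete orthogonality. For [k < n + 1] the closed form contains [sin (k PI) = 0], and
    [cos (b/2)] can be cancelled since [0 <= b < PI]; for [k = n + 1] every summand is [1]. *)
Lemma trapezoid_alt_cos_grid (n k : nat) : (k <= n.+1)%N ->
  trapezoid n (fun m => ((-1) ^ m * cos (INR m * (INR k * PI / INR n.+1)))%R)
    = if k == n.+1 then RtoC (2 * INR n.+1) else 0.
Proof.
have HN : (0 < INR n.+1)%R by apply/lt_0_INR/leP.
case: eqP => [-> _ | Hk Hkn].
  rewrite (_ : (INR n.+1 * PI / INR n.+1)%R = PI); last by field; lra.
  clear HN; elim: n => [|n IH].
    rewrite /trapezoid big_geq // !cos_mult_PI !alt_sq Cmult_0_r -!RtoC_plus.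
    by congr RtoC; rewrite /=; ring.
  rewrite trapezoidS IH !cos_mult_PI !alt_sq -!RtoC_plus; congr RtoC.
  by rewrite (S_INR n.+1); ring.
have {Hk}Hkn : (k < n.+1)%N by rewrite ltn_neqAle Hkn andbT; apply/eqP.
set b := (INR k * PI / INR n.+1)%R.
have Hb : (0 <= b < PI)%R.
  have Hk : (INR k < INR n.+1)%R by apply/lt_INR/ltP.
  have Pp := PI_RGT_0; have k0 := pos_INR k.
  rewrite /b /Rdiv; split.
    by apply: Rmult_le_pos; [nra | apply/Rlt_le/Rinv_0_lt_compat].
  apply: (Rmult_lt_reg_r (INR n.+1)) => //.
  by rewrite Rmult_assoc Rinv_l; [nra | lra].
have Hc : (0 < cos (b / 2))%R by apply: cos_gt_0; lra.
have := trapezoid_alt_cos n b.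
rewrite (_ : (INR n.+1 * b)%R = (INR k * PI)%R); last by rewrite /b; field; lra.
rewrite sin_mult_PI Rmult_0_r Rmult_0_l => H.
have Hc0 : RtoC (cos (b / 2)) <> 0 by move/RtoC_inj; lra.
by rewrite -[LHS](Cmult_1_l) -(Cinv_l _ Hc0) -Cmult_assoc H Cmult_0_r.
Qed.

(** Partial fractions in [Ccos phi] with poles at the values of the cosine on the grid
    [m PI / (n + 1)]; these become the Mittag-Leffler terms in the limit. *)
Definition grid_term (n : nat) (phi : C) (k m : nat) : C :=
  ((-1) ^ m * cos (INR m * (INR k * PI / INR n.+1)))%R / (cos (INR m * PI / INR n.+1) - Ccos phi).

Lemma cos_three_term (x y : R) : (cos (x + y) + cos (x - y) = 2 * cos y * cos x)%R.
Proof. by rewrite cos_plus cos_minus; ring. Qed.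

(* As a function of [k], [trapezoid n (grid_term n phi k)] satisfies the difference equation of
   [Ccos (k phi)] for [k < n + 1]; at [k = n + 1] there is a defect, which determines the
   constant of proportionality. *)
Lemma trapezoid_grid_term (n : nat) (phi : C) (k : nat) :
  (forall m, (m <= n.+1)%N -> cos (INR m * PI / INR n.+1) - Ccos phi <> 0) ->
  (k <= n.+1)%N ->
  trapezoid n (grid_term n phi k) * (Csin (INR n.+1 * phi) * Csin phi)
    = 2 * INR n.+1 * Ccos (INR k * phi).
Proof.
move=> Hne Hk; pose v j := trapezoid n (grid_term n phi j).
have HN : (0 < INR n.+1)%R by apply/lt_0_INR/leP.
have I0 : INR 0 = 0%R by [].
have I1 : INR 1 = 1%R by [].
(* The numerator for [k = 1] is that for [k = 0] times [cos (m PI / N)], [N = n + 1]. Subtracting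
   [Ccos phi] times the latter cancels the denominator and leaves an alternating sum, which
   vanishes. *)
have step0 : v 1%N = Ccos phi * v 0%N.
  have E : trapezoid n (fun m => ((-1) ^ m * cos (INR m * (INR 0 * PI / INR n.+1)))%R)
      = 1 * v 1%N + - Ccos phi * v 0%N.
    apply: trapezoid_linear => m Hm; rewrite /grid_term.
    rewrite (_ : (INR 0 * PI / INR n.+1)%R = 0%R); last by rewrite ?(I0, I1); field; lra.
    rewrite Rmult_0_r cos_0 Rmult_1_r.
    rewrite (_ : (INR m * (INR 1 * PI / INR n.+1))%R = (INR m * PI / INR n.+1)%R);
      last by rewrite ?(I0, I1); field; lra.
    rewrite RtoC_mult; have H := Hne m Hm; by field.
  rewrite trapezoid_alt_cos_grid //= in E.
  rewrite (_ : v 1%N = Ccos phi * v 0%N + (1 * v 1%N + - Ccos phi * v 0%N)); last by ring.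
  by rewrite -E Cplus_0_r.
(* With [x] and [y] as below, [2 cos x cos y = 2 cos x (cos y - Ccos phi) + 2 cos x Ccos phi]. The
   first part cancels the denominator, so orthogonality makes it zero except at [j + 1 = N], where
   it gives the defect [4 N]. *)
have step j : (j < n.+1)%N -> v j.+2 + v j - 2 * Ccos phi * v j.+1
    = if j == n then 4 * INR n.+1 else 0.
  move=> Hj.
  have E : trapezoid n (fun m => grid_term n phi j.+2 m + grid_term n phi j m)
      = 2 * Ccos phi * v j.+1
        + 2 * trapezoid n (fun m => ((-1) ^ m * cos (INR m * (INR j.+1 * PI / INR n.+1)))%R).
    apply: trapezoid_linear => m Hm; rewrite /grid_term.
    set y := (INR m * PI / INR n.+1)%R; set x := (INR m * (INR j.+1 * PI / INR n.+1))%R.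
    rewrite (_ : (INR m * (INR j.+2 * PI / INR n.+1))%R = (x + y)%R); last first.
      by rewrite /x /y (S_INR j.+1); field; lra.
    rewrite (_ : (INR m * (INR j * PI / INR n.+1))%R = (x - y)%R); last first.
      by rewrite /x /y (S_INR j); field; lra.
    rewrite /Cdiv -Cmult_plus_distr_r -RtoC_plus -Rmult_plus_distr_l cos_three_term.
    rewrite !RtoC_mult; have H := Hne m Hm; rewrite -/y in H; by field.
  have E2 : v j.+2 + v j = trapezoid n (fun m => grid_term n phi j.+2 m + grid_term n phi j m).
    rewrite [RHS](trapezoid_linear n 1 1 (grid_term n phi j.+2) (grid_term n phi j)) //;
      last by move=> *; ring.
    by rewrite !Cmult_1_l.
  rewrite E2 E trapezoid_alt_cos_grid // eqSS; case: eqP => _; rewrite ?(RtoC_mult 2 (INR _)); ring.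
have vk j : (j < n.+1)%N -> v j = v 0%N * Ccos (INR j * phi) /\ v j.+1 = v 0%N * Ccos (INR j.+1 * phi).
  elim: j => [|j IH] Hj.
    by rewrite step0 /= Cmult_0_l Cmult_1_l Ccos_RtoC cos_0; split; ring.
  have [H1 H2] := IH (ltnW Hj); split=> //.
  have := step j (ltnW Hj); rewrite (_ : (j == n) = false); last by apply/eqP; lia.
  move=> E; rewrite (_ : v j.+2 = (v j.+2 + v j - 2 * Ccos phi * v j.+1) + (2 * Ccos phi * v j.+1 - v j));
    last by ring.
  rewrite E H1 H2.
  rewrite (_ : INR j.+2 * phi = INR j.+1 * phi + phi); last by rewrite (S_INR j.+1) RtoC_plus; ring.
  rewrite (_ : INR j * phi = INR j.+1 * phi - phi); last by rewrite (S_INR j) RtoC_plus; ring.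
  by rewrite Ccos_plus Ccos_minus; ring.
have [vn vn1] := vk n (ltnSn n).
(* Reflection in [k = N]: on the grid [cos (m (N + 1) PI / N)] and [cos (m (N - 1) PI / N)] agree
   because [sin (m PI) = 0]. *)
have sym : v n.+2 = v n.
  rewrite /v -[RHS]Cmult_1_l -[RHS]Cplus_0_r -(Cmult_0_l (v 0%N)).
  apply: trapezoid_linear => m Hm; rewrite Cmult_0_l Cplus_0_r Cmult_1_l /grid_term.
  congr (RtoC (_ * _) / _).
  rewrite (_ : (INR m * (INR n.+2 * PI / INR n.+1))%R = (INR m * PI + INR m * PI / INR n.+1)%R);
    last first.
    by rewrite (S_INR n.+1); field; lra.
  rewrite (_ : (INR m * (INR n * PI / INR n.+1))%R = (INR m * PI - INR m * PI / INR n.+1)%R);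
    last first.
    by move: HN; rewrite (S_INR n) => HN; field; lra.
  by rewrite cos_plus cos_minus sin_mult_PI !Rmult_0_l; ring.
(* By the reflection the defect equation reads [2 v_n - 2 Ccos phi v_(n+1) = 4 N]; inserting the
   cosine form of both values leaves [2 v_0 Csin (N phi) Csin phi = 4 N]. *)
have key : v 0%N * (Csin (INR n.+1 * phi) * Csin phi) = 2 * INR n.+1.
  have := step n (ltnSn n); rewrite eqxx sym vn vn1.
  rewrite (_ : INR n * phi = INR n.+1 * phi - phi); last by rewrite (S_INR n) RtoC_plus; ring.
  rewrite Ccos_minus => E.
  have H2 := C2_neq0.
  rewrite (_ : 2 * INR n.+1 = (4 * INR n.+1) / 2); last by field.
  by rewrite -E; field.
rewrite -/(v k) (_ : v k = v 0%N * Ccos (INR k * phi)).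
  by rewrite -key; ring.
move: Hk; rewrite leq_eqVlt => /orP [/eqP -> // | Hk].
by have [-> _] := vk k Hk.
Qed.

(** * The limit of the finite identity *)

Lemma Cmod_le_Re_Im (z : C) : (Cmod z <= Rabs (Re z) + Rabs (Im z))%R.
Proof.
rewrite {1}(_ : z = Re z + Ci * Im z); last first.
  by case: z => a b; rewrite /Cplus /Cmult /=; congr (_, _); ring.
by apply: Rle_trans (Cmod_triangle _ _) _; rewrite Cmod_mult Cmod_Ci !Cmod_R; lra.
Qed.

Lemma Clim_Re_Im (f : nat -> C) (l : C) :
  is_lim_seq (fun n => Re (f n)) (Re l) -> is_lim_seq (fun n => Im (f n)) (Im l) ->
  Clim eventually f l.
Proof.
move=> /is_lim_seq_spec Hr /is_lim_seq_spec Hi eps He.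
have He2 : (0 < eps / 2)%R by lra.
refine (filter_imp2 _ _ _ (Hr (mkposreal _ He2)) (Hi (mkposreal _ He2)) _) => n /= H1 H2.
apply: Rle_lt_trans (Cmod_le_Re_Im _) _.
have -> : Re (f n - l) = (Re (f n) - Re l)%R by [].
have -> : Im (f n - l) = (Im (f n) - Im l)%R by [].
lra.
Qed.

Lemma Clim_RtoC (u : nat -> R) (l : R) : is_lim_seq u l -> Clim eventually (fun n => RtoC (u n)) l.
Proof. by move=> H; apply: Clim_Re_Im => //=; apply: is_lim_seq_const. Qed.

Lemma is_lim_seq_inv_S : is_lim_seq (fun n => / INR n.+1)%R 0%R.
Proof.
have := is_lim_seq_inv (fun n => INR n.+1) p_infty; apply=> //.
exact/(is_lim_seq_incr_1 INR)/is_lim_seq_INR.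
Qed.

Lemma is_lim_seq_difference_quotient (f : R -> R) (d : R) :
  is_derive f 0%R d -> is_lim_seq (fun n => (INR n.+1 * (f (/ INR n.+1) - f 0))%R) d.
Proof.
move=> /is_derive_Reals Hf; apply/is_lim_seq_spec => eps.
have [dl Hdl] := Hf eps (cond_pos eps).
have /is_lim_seq_spec /(_ dl) := is_lim_seq_inv_S.
refine (filter_imp _ _ _) => n; rewrite Rminus_0_r => H.
have HN : (0 < INR n.+1)%R by apply/lt_0_INR/leP.
have := Hdl (/ INR n.+1)%R (Rgt_not_eq _ _ (Rinv_0_lt_compat _ HN)) H.
by rewrite Rplus_0_l /Rdiv Rinv_inv Rmult_comm.
Qed.

Lemma Cexp_scal (y : C) (s : R) : Cexp (y * s) =
  ((exp (Re y * s) * cos (Im y * s))%R, (exp (Re y * s) * sin (Im y * s))%R).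
Proof.
case: y => a b; rewrite /Cexp /Cmult /=.
have E1 : (a * s - b * 0 = a * s)%R by ring.
have E2 : (a * 0 + b * s = b * s)%R by ring.
by rewrite E1 E2.
Qed.

(** The derivative of [Cexp (y s)] at [s = 0], taken separately for the real and the imaginary part
    along [s = 1 / (n + 1)]. *)
Lemma Clim_Cexp_quotient (y : C) :
  Clim eventually (fun n => INR n.+1 * (Cexp (y * (/ INR n.+1)%R) - 1)) y.
Proof.
apply: (Clim_ext (fun n => ((INR n.+1 * (exp (Re y * / INR n.+1) * cos (Im y * / INR n.+1) - 1))%R,
   (INR n.+1 * (exp (Re y * / INR n.+1) * sin (Im y * / INR n.+1)))%R))).
  move=> n; rewrite Cexp_scal /Cminus /Cplus /Cmult /= -/(INR n.+1); congr (_, _); ring.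
apply: Clim_Re_Im => /=.
  have := is_lim_seq_difference_quotient (fun s => exp (Re y * s) * cos (Im y * s))%R (Re y).
  rewrite !Rmult_0_r exp_0 cos_0 Rmult_1_r; apply.
  by auto_derive => //; rewrite !Rmult_0_r exp_0 cos_0 sin_0; ring.
have := is_lim_seq_difference_quotient (fun s => exp (Re y * s) * sin (Im y * s))%R (Im y).
rewrite !Rmult_0_r exp_0 sin_0 Rmult_0_r => H.
apply: is_lim_seq_ext (H _) => [n|]; first by rewrite Rminus_0_r.
by auto_derive => //; rewrite !Rmult_0_r exp_0 cos_0 sin_0; ring.
Qed.

Lemma Clim_Csin_scaled (y : C) :
  Clim eventually (fun n => INR n.+1 * Csin (y * (/ INR n.+1)%R)) y.
Proof.
have Hi := Ci_neq0; have H2 := C2_neq0.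
pose proof (Clim_minus _ _ _ _ (Clim_Cexp_quotient (Ci * y)) (Clim_Cexp_quotient (- (Ci * y)))) as H.
pose proof (Clim_mult _ _ _ _ H (Clim_const (/ (2 * Ci)))) as K; move: K.
rewrite (_ : (Ci * y - - (Ci * y)) * / (2 * Ci) = y); last by field.
apply: Clim_ext => n; rewrite /Csin.
set s := RtoC (/ _)%R.
rewrite (_ : Ci * y * s = Ci * (y * s)); last by ring.
rewrite (_ : - (Ci * y) * s = - (Ci * (y * s))); last by ring.
by field.
Qed.

Lemma Clim_one_sub_Ccos_scaled (y : C) :
  Clim eventually (fun n => INR n.+1 ^ 2 * (1 - Ccos (y * (/ INR n.+1)%R))) (y ^ 2 / 2).
Proof.
have H2 := C2_neq0.
have H := Clim_Csin_scaled (y / 2).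
pose proof (Clim_mult _ _ _ _ (Clim_const 2) (Clim_mult _ _ _ _ H H)) as K; move: K.
rewrite (_ : 2 * (y / 2 * (y / 2)) = y ^ 2 / 2); last by field.
apply: Clim_ext => n; rewrite Ccos_half_angle.
set s := RtoC (/ _)%R.
rewrite (_ : y * s / 2 = y / 2 * s); last by field.
ring.
Qed.

Lemma Clim_Cexp_ray (u : nat -> R) (s : R) (z : C) :
  is_lim_seq u s -> Clim eventually (fun n => Cexp (z * u n)) (Cexp (z * s)).
Proof.
move=> Hu.
apply: (Clim_ext (fun n => ((exp (Re z * u n) * cos (Im z * u n))%R,
  (exp (Re z * u n) * sin (Im z * u n))%R))); first by move=> n; rewrite Cexp_scal.
rewrite Cexp_scal; apply: Clim_Re_Im => /=.
  apply: (is_lim_seq_continuous (fun r => exp (Re z * r) * cos (Im z * r))%R) => //.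
  by apply: derivable_continuous_pt; reg.
apply: (is_lim_seq_continuous (fun r => exp (Re z * r) * sin (Im z * r))%R) => //.
by apply: derivable_continuous_pt; reg.
Qed.

Lemma Clim_Ccos_ray (u : nat -> R) (s : R) (z : C) :
  is_lim_seq u s -> Clim eventually (fun n => Ccos (z * u n)) (Ccos (z * s)).
Proof.
move=> Hu.
pose proof (Clim_plus _ _ _ _ (Clim_Cexp_ray u s (Ci * z) Hu) (Clim_Cexp_ray u s (- (Ci * z)) Hu)) as H.
pose proof (Clim_mult _ _ _ _ H (Clim_const (/ 2))) as K; move: K.
have E r : Ccos (z * r) = (Cexp (Ci * z * r) + Cexp (- (Ci * z) * r)) * / 2.
  rewrite /Ccos (_ : Ci * z * r = Ci * (z * r)); last by ring.
  by rewrite (_ : - (Ci * z) * r = - (Ci * (z * r))); last by ring.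
by rewrite E; apply: Clim_ext => n; rewrite E.
Qed.

(** With [h = t / 2 <= 2], the Taylor bound [h - h^3 / 6 <= sin h] gives [sin h >= h / 3], and
    [1 - cos t = 2 sin^2 h]. *)
Lemma one_sub_cos_ge (t : R) : (0 <= t <= PI)%R -> (t ^ 2 / 18 <= 1 - cos t)%R.
Proof.
move=> Ht; pose h := (t / 2)%R.
have Pp := PI_RGT_0; have P4 := PI_4.
have [Hs _] : (sin_approx h (2 * 0 + 1)%coq_nat <= sin h <= sin_approx h (2 * (0 + 1))%coq_nat)%R.
  by apply: sin_bound; rewrite /h; lra.
have Hl : (h / 3 <= sin h)%R.
  apply: Rle_trans Hs; rewrite /sin_approx /sin_term /=.
  have h0 : (0 <= h <= 2)%R by rewrite /h; lra.
  have : (0 <= h * (4 - h * h))%R by apply: Rmult_le_pos; nra.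
  by lra.
have -> : (1 - cos t = 2 * (sin h * sin h))%R.
  rewrite (_ : t = 2 * h)%R; last by rewrite /h; field.
  by rewrite cos_2a_sin; ring.
have : (h / 3 * (h / 3) <= sin h * sin h)%R by apply: Rmult_le_compat; rewrite /h in Hl *; lra.
by rewrite /h; lra.
Qed.

(** The finitely many [m < M] are added one at a time: since [d n m] tends to [l m <> 0], eventually
    its modulus exceeds [Cmod (l m) / 2], which bounds the inverse. *)
Lemma eventually_inv_bound (P : nat -> nat -> Prop) (d : nat -> nat -> C) (l : nat -> C)
    (h : nat -> R) (M : nat) :
  (forall m, Clim eventually (fun n => d n m) (l m)) ->
  (forall m, l m <> 0) -> (forall m, (0 < h m)%R) ->
  (exists B : R, eventually (fun n => forall m, (M <= m)%N -> P n m ->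
     d n m <> 0 /\ (Cmod (/ d n m) <= B * h m)%R)) ->
  exists B : R, eventually (fun n => forall m, P n m ->
     d n m <> 0 /\ (Cmod (/ d n m) <= B * h m)%R).
Proof.
move=> Hd Hl Hh; elim: M => [|M IH] [B H].
  by exists B; refine (filter_imp _ _ _ H) => n Hn m; apply: Hn.
apply: IH; pose B' := (/ (Cmod (l M) / 2) / h M)%R; exists (Rmax B B').
have HlM : (0 < Cmod (l M))%R by apply/Cmod_gt_0.
refine (filter_imp2 _ _ _ H (Clim_away _ _ (Hd M) (Hl M)) _) => n H1 H2 m.
have hm := Hh m.
rewrite leq_eqVlt => /orP [/eqP <- _ | Hm HP].
  have Hn : d n M <> 0 by apply/Cmod_gt_0; lra.
  split=> //; rewrite Cmod_inv //; apply: (Rle_trans _ (B' * h M)); last first.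
    by apply: Rmult_le_compat_r; [apply/Rlt_le/Hh | apply: Rmax_r].
  rewrite /B' /Rdiv Rmult_assoc Rinv_l; last by apply/Rgt_not_eq/Hh.
  by rewrite Rmult_1_r; apply: Rinv_le_contravar; lra.
have [Hn HB] := H1 m Hm HP; split=> //; apply: Rle_trans HB _.
by apply: Rmult_le_compat_r; [lra | apply: Rmax_l].
Qed.

(** Series are indexed from [0], so [n] here stands for the index [n + 1] of the theorem, with sign
    [(-1)^((n+1)-1)]. *)
Definition cos_coef (theta : R) (n : nat) : R := ((-1) ^ n * cos (INR n.+1 * theta))%R.

Lemma Rabs_cos_coef_le1 (theta : R) (n : nat) : (Rabs (cos_coef theta n) <= 1)%R.
Proof.
rewrite /cos_coef Rabs_mult -RPow_abs Rabs_m1 pow1 Rmult_1_l.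
by apply: Rabs_le; apply: COS_bound.
Qed.

(** Take [k n] as the integer part of [theta N / PI] with [N = n + 1]; the grid point then lies
    within [PI / N] below [theta]. *)
Lemma exists_grid_approx (theta : R) : (0 <= theta <= PI)%R ->
  exists k : nat -> nat, (forall n, (k n <= n.+1)%N) /\
    is_lim_seq (fun n => INR (k n) * PI / INR n.+1)%R theta.
Proof.
move=> Ht; have Pp := PI_RGT_0.
have nn n : (0 <= theta / PI * INR n.+1)%R.
  by apply: Rmult_le_pos; [apply: Rdiv_le_0_compat; lra | apply: pos_INR].
have tP : (theta / PI <= 1)%R by apply: (Rmult_le_reg_r PI) => //; rewrite /Rdiv Rmult_assoc Rinv_l; lra.
pose k n := nfloor _ (nn n).
have kP n : (INR (k n) <= theta / PI * INR n.+1 < INR (k n) + 1)%R.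
  by rewrite /k /nfloor; case: nfloor_ex.
exists k; split=> [n|].
  apply/leP/INR_le; have := kP n; have : (0 < INR n.+1)%R by apply/lt_0_INR/leP.
  by nra.
have Hinv := is_lim_seq_scal_l _ (- PI) _ is_lim_seq_inv_S.
have := is_lim_seq_plus' _ _ _ _ (is_lim_seq_const theta) Hinv.
rewrite /= Rmult_0_r Rplus_0_r => Hlow.
apply: (is_lim_seq_le_le _ _ _ theta _ Hlow (is_lim_seq_const theta)) => n.
have HN : (0 < INR n.+1)%R by apply/lt_0_INR/leP.
have [H1 H2] := kP n.
rewrite -/(INR n.+1); split.
  apply: (Rmult_le_reg_r (INR n.+1 / PI)); first by apply: Rdiv_lt_0_compat.
  rewrite (_ : (INR (k n) * PI / INR n.+1 * (INR n.+1 / PI))%R = INR (k n)); last by field; lra.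
  rewrite (_ : ((theta + - PI * / INR n.+1) * (INR n.+1 / PI))%R = (theta / PI * INR n.+1 - 1)%R);
    last by field; lra.
  lra.
apply: (Rmult_le_reg_r (INR n.+1 / PI)); first by apply: Rdiv_lt_0_compat.
rewrite (_ : (INR (k n) * PI / INR n.+1 * (INR n.+1 / PI))%R = INR (k n)); last by field; lra.
rewrite (_ : (theta * (INR n.+1 / PI))%R = (theta / PI * INR n.+1)%R); last by field; lra.
lra.
Qed.

Lemma Cinv_neq0 (z : C) : z <> 0 -> / z <> 0.
Proof. by move=> Hz E; have := Cinv_r z Hz; rewrite E Cmult_0_r => /RtoC_inj; lra. Qed.

(** Tends to [y^2 / 2]. The difference of its values at [PI z] and [m PI] is [(n + 1)^2] times the
    denominator of [grid_term] at [phi = PI z / (n + 1)], so the rescaled denominators have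
    limits. *)
Definition scaled_gap (y : C) (n : nat) : C := INR n.+1 ^ 2 * (1 - Ccos (y * (/ INR n.+1)%R)).

Lemma scaled_gap_RtoC (t : R) (n : nat) :
  scaled_gap t n = (INR n.+1 ^ 2 * (1 - cos (t / INR n.+1)))%R.
Proof. by rewrite /scaled_gap -RtoC_mult Ccos_RtoC -RtoC_minus RtoC_mult -RtoC_pow. Qed.

Lemma scaled_gap_ge (n m : nat) : (m <= n.+1)%N ->
  (INR m ^ 2 / 18 <= Cmod (scaled_gap (INR m * PI)%R n))%R.
Proof.
move=> Hm; rewrite scaled_gap_RtoC.
have HN : (0 < INR n.+1)%R by apply/lt_0_INR/leP.
have Hm' : (INR m <= INR n.+1)%R by apply/le_INR/leP.
have m0 := pos_INR m; have Pp := PI_RGT_0; have P3 := PI2_3_2.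
rewrite Cmod_R; apply: Rle_trans (Rle_abs _).
have Ht : (0 <= INR m * PI / INR n.+1 <= PI)%R.
  split; first by apply: Rmult_le_pos; [nra | apply/Rlt_le/Rinv_0_lt_compat].
  apply: (Rmult_le_reg_r (INR n.+1)) => //.
  by rewrite /Rdiv Rmult_assoc Rinv_l; [nra | lra].
have := Rmult_le_compat_l (INR n.+1 ^ 2) _ _ (pow2_ge_0 _) (one_sub_cos_ge _ Ht).
apply: Rle_trans.
rewrite (_ : (_ * _)%R = (INR m ^ 2 * PI ^ 2 / 18)%R); last by field; lra.
have M0 : (0 <= INR m ^ 2)%R by apply: pow2_ge_0.
have P1 : (1 <= PI ^ 2)%R by nra.
have := Rmult_le_compat_l _ _ _ M0 P1; lra.
Qed.

(** The finite identity divided by [2 (n + 1)], arranged so that every piece converges: the node [0]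
    gives the polar term, and the last node keeps the weight [1/2]. The minus signs come from
    [(-1)^(m+1)]. *)
Lemma trapezoid_limit_form (n k : nat) (z : C) :
  let phi := PI * z * (/ INR n.+1)%R in
  let d m := scaled_gap (PI * z) n - scaled_gap (INR m.+1 * PI)%R n in
  let b := (INR k * PI / INR n.+1)%R in
  scaled_gap (PI * z) n <> 0 -> (forall m, (m <= n)%N -> d m <> 0) -> (k <= n.+1)%N ->
  (/ (2 * scaled_gap (PI * z) n) + \big[Cplus/RtoC 0]_(0 <= m < n) (- cos_coef b m * / d m)
     + / 2 * (- cos_coef b n * / d n)) * (Csin (PI * z) * (INR n.+1 * Csin phi))
  = Ccos (z * b).
Proof.
move=> phi d b Hw Hd Hk.
have HN : (0 < INR n.+1)%R by apply/lt_0_INR/leP.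
have HN0 : RtoC (INR n.+1) <> 0 by move/RtoC_inj; lra.
have H2 := C2_neq0.
have gap m : cos (INR m * PI / INR n.+1) - Ccos phi
    = (scaled_gap (PI * z) n - scaled_gap (INR m * PI)%R n) / INR n.+1 ^ 2.
  rewrite scaled_gap_RtoC /scaled_gap -/phi RtoC_mult RtoC_minus RtoC_pow.
  by field.
have gap0 : scaled_gap (INR 0 * PI)%R n = 0.
  by rewrite scaled_gap_RtoC Rmult_0_l /Rdiv Rmult_0_l cos_0 Rminus_diag Rmult_0_r.
have Hne m : (m <= n.+1)%N -> cos (INR m * PI / INR n.+1) - Ccos phi <> 0.
  move=> Hm; rewrite gap; apply: Cmult_neq_0; last by apply: Cinv_neq0; apply: Cpow_nz.
  by case: m Hm => [_|m Hm]; [rewrite gap0 (_ : _ - 0 = scaled_gap (PI * z) n) //; ring | exact: Hd].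
have := trapezoid_grid_term n phi k Hne Hk.
have term0 : grid_term n phi k 0 = 2 * INR n.+1 ^ 2 * / (2 * scaled_gap (PI * z) n).
  have E : scaled_gap (PI * z) n - 0 = scaled_gap (PI * z) n by ring.
  by rewrite /grid_term gap gap0 E Rmult_0_l cos_0 Rmult_1_r pow_O; field.
have termS m : (m <= n)%N -> grid_term n phi k m.+1 = INR n.+1 ^ 2 * (- cos_coef b m * / d m).
  move=> Hm; rewrite /grid_term gap /cos_coef -/b -/(d m).
  rewrite (_ : ((-1) ^ m.+1 * cos (INR m.+1 * b))%R = (- ((-1) ^ m * cos (INR m.+1 * b)))%R);
    last first.
    by rewrite /=; ring.
  rewrite RtoC_opp; have := Hd m Hm => H; by field.
rewrite /trapezoid term0 termS //.
have -> : \big[Cplus/RtoC 0]_(0 <= m < n) grid_term n phi k m.+1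
    = INR n.+1 ^ 2 * \big[Cplus/RtoC 0]_(0 <= m < n) (- cos_coef b m * / d m).
  rewrite big_distrr; apply: eq_big_nat => m /andP [_ Hm].
  exact: termS (ltnW Hm).
set A := / (2 * _); set B := bigop _ _ _; set D := - _ * _.
rewrite (_ : INR n.+1 * phi = PI * z); last first.
  by rewrite /phi RtoC_inv; [field | lra].
rewrite (_ : INR k * phi = z * b); last first.
  by rewrite /phi /b /Rdiv !RtoC_mult RtoC_inv; [field | lra].
move=> E.
have H2N : 2 * INR n.+1 <> 0 by apply: Cmult_neq_0.
rewrite -[RHS]Cmult_1_l -(Cinv_l _ H2N) -Cmult_assoc -E; by field.
Qed.

Lemma RtoC_PI_neq0 : RtoC PI <> 0.
Proof. by move/RtoC_inj; have := PI_RGT_0; lra. Qed.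

Lemma Clim_cos_coef (b : nat -> R) (theta : R) (m : nat) :
  is_lim_seq b theta -> Clim eventually (fun n => cos_coef (b n) m : C) (cos_coef theta m).
Proof.
move=> Hb; apply: Clim_RtoC; apply: (is_lim_seq_continuous (fun t => cos_coef t m)) => //.
by apply: derivable_continuous_pt; rewrite /cos_coef; reg.
Qed.

(** The limit of [trapezoid_limit_form] along grid angles tending to [theta]. [Csin (PI z)] stays
    multiplied out, so that its nonvanishing can be deduced from this identity afterwards. *)
Lemma cos_series_aux (z : C) (theta : R) :
  z <> 0 -> (forall m : nat, INR m.+1 ^ 2 - z ^ 2 <> 0) -> (0 <= theta <= PI)%R ->
  exists L : C, is_series (fun m => cos_coef theta m / (INR m.+1 ^ 2 - z ^ 2)) L /\
    (1 / (2 * z ^ 2) + L) * (2 * z * Csin (PI * z)) = PI * Ccos (z * theta).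
Proof.
move=> Hz Hne Ht.
have Hpi := RtoC_PI_neq0; have H2 := C2_neq0.
have [k [Hk Hb]] := exists_grid_approx theta Ht.
pose b n := (INR (k n) * PI / INR n.+1)%R.
pose w n := scaled_gap (PI * z) n.
pose d n m := w n - scaled_gap (INR m.+1 * PI)%R n.
have Hw : Clim eventually w ((PI * z) ^ 2 / 2) by apply: Clim_one_sub_Ccos_scaled.
have Hw0 : (PI * z) ^ 2 / 2 <> 0.
  by apply: Cmult_neq_0; [apply: Cpow_nz; apply: Cmult_neq_0 | apply: Cinv_neq0].
pose l (m : nat) : C := - (PI ^ 2 * (INR m.+1 ^ 2 - z ^ 2) / 2).
have Hd m : Clim eventually (fun n => d n m) (l m).
  rewrite (_ : l m = (PI * z) ^ 2 / 2 - RtoC (INR m.+1 * PI) ^ 2 / 2); last first.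
    by rewrite /l RtoC_mult; field.
  by apply: Clim_minus => //; apply: Clim_one_sub_Ccos_scaled.
have Hl m : l m <> 0.
  have A : PI ^ 2 * (INR m.+1 ^ 2 - z ^ 2) / 2 <> 0.
    apply: Cmult_neq_0; last exact: Cinv_neq0.
    by apply: Cmult_neq_0 => //; apply: Cpow_nz.
  move=> E; apply: A; rewrite (_ : _ / 2 = - l m); last by rewrite /l; ring.
  by rewrite E; ring.
pose W := (Cmod ((PI * z) ^ 2 / 2) + 1)%R.
have HW : (0 < W)%R by rewrite /W; have := Cmod_ge_0 ((PI * z) ^ 2 / 2); lra.
(* For [m >= 36 W] one has [W <= m / 36], so that [(m + 1)^2 / 18 - W >= (1 + m^2) / 36]; [W]
   eventually bounds [Cmod (w n)]. *)
have [M HM] := INR_large (36 * W).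
have [B HB] : exists B : R, eventually (fun n => forall m, (m <= n)%N ->
    d n m <> 0 /\ (Cmod (/ d n m) <= B * quad_decay (INR m))%R).
  apply: (eventually_inv_bound (fun n m => (m <= n)%N) d l _ M) => //.
    by move=> m; apply: quad_decay_pos.
  exists 36%R; refine (filter_imp _ _ _ (Hw 1%R Rlt_0_1)) => n Hn m HMm Hmn.
  have Hlow := scaled_gap_ge n m.+1 Hmn.
  have Hwn : (Cmod (w n) <= W)%R.
    have := Cmod_triangle (w n - (PI * z) ^ 2 / 2) ((PI * z) ^ 2 / 2).
    by rewrite (_ : _ - _ + _ = w n); [rewrite /W; lra | ring].
  have Htri := Cmod_triangle (d n m) (- w n).
  rewrite (_ : d n m + - w n = - scaled_gap (INR m.+1 * PI)%R n) in Htri; last by rewrite /d; ring.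
  rewrite !Cmod_opp in Htri.
  have Hm := HM m HMm.
  have Hlarge : (/ 36 * (1 + INR m ^ 2) <= Cmod (d n m))%R.
    move: Hlow Htri; set G := Cmod (scaled_gap _ _); rewrite S_INR.
    by have := pos_INR m; nra.
  have m0 := pos_INR m.
  split; first by apply/Cmod_gt_0; nra.
  have -> : 36%R = (/ / 36)%R by rewrite Rinv_inv.
  by apply: Cmod_inv_le_quad_decay; lra.
(* The finite sums are extended by zero to series, to which dominated convergence applies. *)
pose f n m := if (m < n)%N then - cos_coef (b n) m * / d n m else 0.
have coef_bound n m (Hdm : (Cmod (/ d n m) <= B * quad_decay (INR m))%R) :
    (Cmod (- cos_coef (b n) m * / d n m) <= B * quad_decay (INR m))%R.
  rewrite Cmod_mult Cmod_opp Cmod_R.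
  apply: Rle_trans Hdm; rewrite -{2}(Rmult_1_l (Cmod _)).
  by apply: Rmult_le_compat_r; [exact: Cmod_ge_0 | exact: Rabs_cos_coef_le1].
have [L' [HL' HS]] : exists L' : C,
    is_series (fun m => - cos_coef theta m / l m) L' /\
    Clim eventually (fun n => \big[Cplus/RtoC 0]_(0 <= m < n) (- cos_coef (b n) m * / d n m)) L'.
  apply: (tannery f _ (fun m => B * quad_decay (INR m))%R).
  - move=> m; apply: (Clim_ext_loc (fun n => - cos_coef (b n) m * / d n m)).
      by exists m.+1 => n /leP Hn; rewrite /f Hn.
    apply: Clim_mult; last exact: Clim_inv.
    by apply: Clim_opp; apply: Clim_cos_coef.
  - exact: (ex_series_scal_l (V := R_NormedModule)) ex_series_quad_decay.
  - refine (filter_imp _ _ _ HB) => n Hn m; rewrite /f; case: ltnP => Hm.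
      by apply: coef_bound; apply: (proj2 (Hn m (ltnW Hm))).
    (* The bound at [m = 0] forces [B] to be nonnegative. *)
    have [_ H0] := Hn 0%N (leq0n n).
    rewrite Cmod_0; apply: Rmult_le_pos; last exact/Rlt_le/quad_decay_pos.
    have := Rle_trans _ _ _ (Cmod_ge_0 _) H0; have := quad_decay_pos (INR 0); nra.
  - by apply: filter_forall => n; apply: is_series_finite.
exists (PI ^ 2 / 2 * L'); split.
  apply: is_series_C_ext (is_series_C_scal (PI ^ 2 / 2) _ _ HL') => // m.
  by rewrite /l; have H := Hne m; field; split.
(* The half-weighted end node moves with [n]; the uniform decay bound makes its contribution
   vanish. *)
have Hlast : Clim eventually (fun n => - cos_coef (b n) n * / d n n) 0.
  apply: (Clim_dominated _ (fun n => B * quad_decay (INR n))%R).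
    refine (filter_imp _ _ _ HB) => n Hn.
    rewrite (_ : _ - 0 = - cos_coef (b n) n * / d n n); last by ring.
    by apply: coef_bound; apply: (proj2 (Hn n (leqnn n))).
  move=> eps He.
  have /is_lim_seq_spec /(_ (mkposreal _ He)) := ex_series_lim_0 _
    (ex_series_scal_l (V := R_NormedModule) B _ ex_series_quad_decay).
  refine (filter_imp _ _ _) => n; rewrite Rminus_0_r => /Rabs_def2 [H _]; exact: H.
have Hleft : Clim eventually (fun n => (/ (2 * w n)
     + \big[Cplus/RtoC 0]_(0 <= m < n) (- cos_coef (b n) m * / d n m)
     + / 2 * (- cos_coef (b n) n * / d n n))
     * (Csin (PI * z) * (INR n.+1 * Csin (PI * z * (/ INR n.+1)%R))))
   ((/ (2 * ((PI * z) ^ 2 / 2)) + L' + / 2 * 0) * (Csin (PI * z) * (PI * z))).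
  apply: Clim_mult; last by apply: Clim_mult; [exact: Clim_const | exact: Clim_Csin_scaled].
  apply: Clim_plus; last by apply: Clim_mult => //; exact: Clim_const.
  apply: Clim_plus => //; apply: Clim_inv; last exact: Cmult_neq_0.
  by apply: Clim_mult => //; exact: Clim_const.
have Hright : Clim eventually (fun n => Ccos (z * b n)) (Ccos (z * theta)).
  exact: Clim_Ccos_ray.
have E : Clim eventually (fun n => Ccos (z * b n))
   ((/ (2 * ((PI * z) ^ 2 / 2)) + L' + / 2 * 0) * (Csin (PI * z) * (PI * z))).
  apply: Clim_ext_loc Hleft.
  refine (filter_imp2 _ _ _ HB (Clim_away _ _ Hw Hw0) _) => n Hn Hwn.
  apply: trapezoid_limit_form => //.
    by apply/Cmod_gt_0; have := Cmod_ge_0 ((PI * z) ^ 2 / 2); rewrite /w in Hwn; lra.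
  by move=> m Hm; apply: (proj1 (Hn m Hm)).
rewrite -(Clim_unique _ _ _ E Hright); field.
by split.
Qed.

(** At [theta = 0] the right side of the series identity is [PI], so the factor [Csin (PI z)] on the
    left cannot vanish. *)
Lemma Csin_PI_mul_neq0 (z : C) :
  z <> 0 -> (forall m : nat, INR m.+1 ^ 2 - z ^ 2 <> 0) -> Csin (PI * z) <> 0.
Proof.
move=> Hz Hne E.
have [|L [_ H]] := cos_series_aux z 0 Hz Hne; first by have := PI_RGT_0; lra.
apply: RtoC_PI_neq0; move: H; rewrite E !Cmult_0_r Ccos_RtoC cos_0 Cmult_1_r.
by move=> ->.
Qed.

(** * The brace as a Mittag-Leffler series *)

Lemma cos_Rabs (t s : R) : cos (t * Rabs s) = cos (t * s).
Proof.
case: (Rle_dec 0 s) => H; first by rewrite Rabs_pos_eq.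
by rewrite Rabs_left; [rewrite -[RHS]cos_neg; congr cos; ring | lra].
Qed.

Lemma Ccos_Rabs (z : C) (s : R) : Ccos (z * Rabs s) = Ccos (z * s).
Proof.
case: (Rle_dec 0 s) => H; first by rewrite Rabs_pos_eq.
rewrite Rabs_left; last by lra.
by rewrite RtoC_opp -[RHS]Ccos_opp; congr Ccos; ring.
Qed.

(** Rescaling by [y = z / x] reduces to the case [x = 1], and evenness of the cosine allows [theta]
    to be replaced by [Rabs theta], which lies in [[0, PI]]. *)
Lemma brace_expr_series (theta : R) (x z : C) :
  (Rabs theta <= PI)%R -> x <> 0 -> z <> 0 ->
  (forall n : nat, x ^ 2 * INR n.+1 ^ 2 - z ^ 2 <> 0) ->
  is_series (fun n => cos_coef theta n / (x ^ 2 * INR n.+1 ^ 2 - z ^ 2)) (brace_expr theta x z).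
Proof.
move=> Ht Hx Hz Hne; pose y := z / x.
have Hy : y <> 0 by apply: Cmult_neq_0 => //; apply: Cinv_neq0.
have Hyne m : INR m.+1 ^ 2 - y ^ 2 <> 0.
  move=> E; apply: (Hne m); rewrite (_ : _ - _ = x ^ 2 * (INR m.+1 ^ 2 - y ^ 2));
    last by rewrite /y; field.
  by rewrite E; ring.
have [|L [HL E]] := cos_series_aux y (Rabs theta) Hy Hyne.
  by split=> //; apply: Rabs_pos.
have HS := Csin_PI_mul_neq0 y Hy Hyne.
apply: is_series_C_ext (is_series_C_scal (/ x ^ 2) _ _ HL) => [m|].
  rewrite /cos_coef cos_Rabs.
  rewrite (_ : x ^ 2 * INR m.+1 ^ 2 - z ^ 2 = x ^ 2 * (INR m.+1 ^ 2 - y ^ 2));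
    last by rewrite /y; field.
  by have := Hyne m => H; field.
have H2 := C2_neq0.
rewrite Ccos_Rabs in E.
have -> : L = PI * Ccos (y * theta) / (2 * y * Csin (PI * y)) - 1 / (2 * y ^ 2).
  by rewrite -E; field.
rewrite /brace_expr.
rewrite (_ : theta * z / x = y * theta); last by rewrite /y; field.
rewrite (_ : PI * z / x = PI * y); last by rewrite /y; field.
set S := Csin _ in HS *; set K := Ccos _.
by rewrite /y; field.
Qed.

Lemma locally'_C_proper (z : C) : ProperFilter (@locally' C_UniformSpace z).
Proof.
split; last exact: locally'_filter.
move=> P [eps H].
exists (z + RtoC (eps / 2)); apply: H.
  apply: (@norm_compat1 C_AbsRing C_NormedModule).
  change (Cmod (z + RtoC (eps / 2) - z) < eps)%R.
  rewrite (_ : z + _ - z = RtoC (eps / 2)); last by ring.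
  by rewrite Cmod_R Rabs_pos_eq; have := cond_pos eps; lra.
move=> E; have := cond_pos eps.
have : RtoC (eps / 2) = 0 by rewrite (_ : RtoC (eps / 2) = z + RtoC (eps / 2) - z);
  [rewrite E; ring | ring].
by move/RtoC_inj; lra.
Qed.

Lemma locally'_C_small (r : R) : (0 < r)%R ->
  @locally' C_UniformSpace (RtoC 0) (fun z : C => z <> 0 /\ (Cmod z < r)%R).
Proof.
move=> Hr; have := @locally_ball_norm _ C_NormedModule (RtoC 0) (mkposreal _ Hr).
rewrite /locally' /within; refine (filter_imp _ _ _) => z H Hz; split=> //.
change (Cmod (z - 0) < r)%R in H.
have E (w : C) : w - 0 = w by ring.
by rewrite E in H.
Qed.

(** For [Cmod z < Cmod x / 2] the denominators are at least [c (1 + n^2)] uniformly in [z], so the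
    series for [z <> 0] passes to the limit [z -> 0]. This limit exists and is therefore the value
    of [C_lim]. *)
Lemma brace_0_series (theta : R) (x : C) :
  (Rabs theta <= PI)%R -> x <> 0 ->
  is_series (fun n => cos_coef theta n / (x ^ 2 * INR n.+1 ^ 2)) (brace theta x 0).
Proof.
move=> Ht Hx; have HF := locally'_C_proper 0.
have Hx' : (0 < Cmod x)%R by apply/Cmod_gt_0.
pose c := (Cmod x ^ 2 / 2)%R.
have Hc : (0 < c)%R by rewrite /c; nra.
have Hr : (0 < Cmod x / 2)%R by lra.
have HN n : INR n.+1 ^ 2 <> 0.
  by apply: Cpow_nz => /RtoC_inj; have := lt_0_INR _ (PeanoNat.Nat.lt_0_succ n); lra.
have away n z : (Cmod z < Cmod x / 2)%R ->
    (c * (1 + INR n ^ 2) <= Cmod (x ^ 2 * INR n.+1 ^ 2 - z ^ 2))%R.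
  move=> Hz; have := Cmod_triangle (x ^ 2 * INR n.+1 ^ 2 - z ^ 2) (z ^ 2).
  rewrite (_ : _ - _ + _ = x ^ 2 * INR n.+1 ^ 2); last by ring.
  rewrite Cmod_mult !Cmod_pow Cmod_INR => H.
  have Hz2 : (Cmod z ^ 2 <= c / 2)%R by rewrite /c; have := Cmod_ge_0 z; nra.
  have : (c * (1 + INR n ^ 2) <= Cmod x ^ 2 * INR n.+1 ^ 2 - c / 2)%R.
    by rewrite (_ : Cmod x ^ 2 = 2 * c)%R;
      [rewrite S_INR; have := pos_INR n; nra | rewrite /c; field].
  lra.
have [L [HL HlimL]] : exists L : C,
    is_series (fun n => cos_coef theta n / (x ^ 2 * INR n.+1 ^ 2)) L /\
    Clim (@locally' C_UniformSpace (RtoC 0)) (brace_expr theta x) L.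
  apply: (tannery (fun z n => cos_coef theta n / (x ^ 2 * INR n.+1 ^ 2 - z ^ 2)) _
    (fun n => / c * quad_decay (INR n))%R).
  - move=> n; apply: Clim_div; first exact: Clim_const.
      rewrite -[X in Clim _ _ X](_ : x ^ 2 * INR n.+1 ^ 2 - 0 * 0 = _); last by ring.
      apply: Clim_minus; first exact: Clim_const.
      have Hid : Clim (@locally' C_UniformSpace (RtoC 0)) (fun z => z) 0.
        move=> eps He; refine (filter_imp _ _ _ (locally'_C_small _ He)) => z [_ H].
        by rewrite (_ : z - 0 = z) //; ring.
      by apply: (Clim_ext (fun z => z * z)); [move=> z; ring | exact: Clim_mult].
    by apply: Cmult_neq_0 => //; apply: Cpow_nz.
  - exact: (ex_series_scal_l (V := R_NormedModule)) ex_series_quad_decay.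
  - refine (filter_imp _ _ _ (locally'_C_small _ Hr)) => z [_ Hz] n.
    rewrite Cmod_mult Cmod_R.
    apply: Rle_trans (Cmod_inv_le_quad_decay _ _ _ Hc (away n z Hz)).
    rewrite -[X in (_ <= X)%R]Rmult_1_l.
    by apply: Rmult_le_compat_r; [exact: Cmod_ge_0 | exact: Rabs_cos_coef_le1].
  - refine (filter_imp _ _ _ (locally'_C_small _ Hr)) => z [Hz0 Hz].
    apply: brace_expr_series => // n; apply/Cmod_gt_0.
    apply: Rlt_le_trans (away n z Hz); apply: Rmult_lt_0_compat => //.
    by have := pow2_ge_0 (INR n); lra.
rewrite (_ : brace theta x 0 = L) //.
rewrite /brace; case: Ceq_dec => [E0 | []] //; apply: is_C_lim_unique => P HP.
apply: (proj2 (Clim_filterlim _ _) HlimL).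
exact: HP.
Qed.

(** The choice of root disappears, since only the square of [sq u] enters the series; a zero root
    falls under the limit case. *)
Lemma brace_series (sq : C -> C) (hsq : forall w, sq w ^ 2 = w) (theta : R) (x u : C) :
  (Rabs theta <= PI)%R -> x <> 0 ->
  (forall n : nat, x ^ 2 * INR n.+1 ^ 2 - u <> 0) ->
  is_series (fun n => cos_coef theta n / (x ^ 2 * INR n.+1 ^ 2 - u)) (brace theta x (sq u)).
Proof.
move=> Ht Hx Hne.
case: (Ceq_dec (sq u) 0) => E.
  have u0 : u = 0 by rewrite -(hsq u) E; ring.
  rewrite E u0; apply: is_series_C_ext (brace_0_series theta x Ht Hx) => // n.
  by rewrite /Cminus Copp_0 Cplus_0_r.
rewrite /brace; case: Ceq_dec => [/E [] | nE].
rewrite -{1}(hsq u); apply: brace_expr_series => // n; rewrite hsq; exact: Hne.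
Qed.

(** * The product of the series *)

Lemma Csum_mul_r (s : seq nat) (a : nat -> C) (y : C) :
  (\big[Cplus/RtoC 0]_(n <- s) a n) * y = \big[Cplus/RtoC 0]_(n <- s) (a n * y).
Proof. exact: big_distrl. Qed.

Lemma Cmult_swap (x y z : C) : x * (y * z) = y * (x * z).
Proof. by ring. Qed.

(* Adjoining an index [k]: [1 / ((mu_k - T) (mu_i - T))] splits into two fractions. The
   first gives the new factor of the old summands; the second, by the induction
   hypothesis at [T = mu_k], gives the summands of index [k]. *)
Lemma prod_simple_fractions (I : eqType) (c mu : I -> nat -> C) (N : nat) (r : seq I) (T : C) :
  uniq r -> r != [::] ->
  (forall i n, i \in r -> mu i n <> T) ->
  (forall i j n m, i \in r -> j \in r -> i != j -> mu i n <> mu j m) ->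
  let F i z := \big[Cplus/RtoC 0]_(0 <= n < N) (c i n / (mu i n - z)) in
  \big[Cmult/RtoC 1]_(i <- r) F i T =
  \big[Cplus/RtoC 0]_(i <- r) \big[Cplus/RtoC 0]_(0 <= n < N)
    (c i n / (mu i n - T) * \big[Cmult/RtoC 1]_(j <- r | j != i) F j (mu i n)).
Proof.
move=> Ur r0 HT Hmu F; elim: r T Ur r0 HT Hmu => // k r IH T /= /andP [kr Ur] _ HT Hmu.
have HTk n : mu k n - T <> 0 by apply: Cminus_eq_contra; apply: HT; rewrite mem_head.
have HTr i n : i \in r -> mu i n - T <> 0.
  by move=> ir; apply: Cminus_eq_contra; apply: HT; rewrite inE ir orbT.
have neq i : i \in r -> i != k by apply: contraTneq => ->.
have Hki i n m : i \in r -> mu k n <> mu i m.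
  by move=> ir; apply: Hmu; rewrite ?mem_head ?inE ?ir ?orbT // eq_sym neq.
have prod_k n : \big[Cmult/RtoC 1]_(j <- k :: r | j != k) F j (mu k n) =
    \big[Cmult/RtoC 1]_(j <- r) F j (mu k n).
  rewrite big_cons eqxx /= [LHS]big_seq_cond [RHS]big_seq.
  by apply: eq_bigl => j; case jr: (j \in r) => //=; rewrite neq.
have prod_i i n : i \in r -> \big[Cmult/RtoC 1]_(j <- k :: r | j != i) F j (mu i n) =
    F k (mu i n) * \big[Cmult/RtoC 1]_(j <- r | j != i) F j (mu i n).
  by move=> ir; rewrite big_cons eq_sym neq.
rewrite !big_cons.
under [X in _ = X + _]eq_bigr => n _ do rewrite prod_k.
rewrite [X in _ = _ + X]big_seq.
under [X in _ = _ + X]eq_bigr => i ir do under eq_bigr => n _ do rewrite prod_i //.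
rewrite -big_seq.
case: (altP (r =P [::])) => [-> | r0].
  rewrite !big_nil Cplus_0_r Cmult_1_r; apply: eq_bigr => n _.
  by rewrite big_nil Cmult_1_r.
have Hmur : forall i j n m, i \in r -> j \in r -> i != j -> mu i n <> mu j m.
  by move=> i j n m ir jr; apply: Hmu; rewrite inE ?ir ?jr orbT.
rewrite (IH T) //; last first.
  by move=> i n ir; apply: HT; rewrite inE ir orbT.
under [X in _ = X + _]eq_bigr => n _.
  rewrite (IH (mu k n)) //; last by move=> i m ir; apply/not_eq_sym/Hki.
  rewrite big_distrr /=.
  under eq_bigr => i _ do rewrite big_distrr /=.
  over.
(* The sums are interchanged so that both contributions belonging to the same pole [mu i n] of the
   old indices stand together. *)
rewrite [X in _ = X + _]exchange_big big_distrr -big_split; apply: eq_big_seq => i ir /=.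
rewrite [X in _ = X + _]exchange_big big_distrr -big_split; apply: eq_bigr => n _ /=.
have H1 := HTr i n ir.
rewrite /F [X in _ = _ + X]Cmult_swap [X in X = _]Csum_mul_r [X in _ = _ + X]Csum_mul_r -big_split.
apply: eq_bigr => m _ /=.
have H2 := HTk m.
have H3 := Cminus_eq_contra _ _ (Hki i m n ir).
have H4 : mu i n - mu k m <> 0 by apply: Cminus_eq_contra; apply: not_eq_sym; apply: Hki.
rewrite -/F; set P := bigop _ _ _.
(* Termwise this is [1 / ((mu_k - T) (mu_i - T)) = 1 / ((mu_k - T) (mu_i - mu_k)) + 1 / ((mu_i - T)
   (mu_k - mu_i))]. *)
by field.
Qed.

Lemma Clim_sum {T I : Type} {F : (T -> Prop) -> Prop} {FF : Filter F}
    (r : seq I) (f : T -> I -> C) (l : I -> C) :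
  (forall i, Clim F (fun t => f t i) (l i)) ->
  Clim F (fun t => \big[Cplus/RtoC 0]_(i <- r) f t i) (\big[Cplus/RtoC 0]_(i <- r) l i).
Proof.
move=> H; elim: r => [|i r IH].
  rewrite big_nil; apply: (Clim_ext (fun _ => RtoC 0)); last exact: Clim_const.
  by move=> t; rewrite big_nil.
rewrite big_cons; apply: (Clim_ext (fun t => f t i + \big[Cplus/RtoC 0]_(j <- r) f t j)).
  by move=> t; rewrite big_cons.
exact: Clim_plus.
Qed.

Lemma Clim_prod {T I : Type} {F : (T -> Prop) -> Prop} {FF : Filter F}
    (r : seq I) (P : pred I) (f : T -> I -> C) (l : I -> C) :
  (forall i, P i -> Clim F (fun t => f t i) (l i)) ->
  Clim F (fun t => \big[Cmult/RtoC 1]_(i <- r | P i) f t i) (\big[Cmult/RtoC 1]_(i <- r | P i) l i).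
Proof.
move=> H; elim: r => [|i r IH].
  rewrite big_nil; apply: (Clim_ext (fun _ => RtoC 1)); last exact: Clim_const.
  by move=> t; rewrite big_nil.
rewrite big_cons; case Pi: (P i).
  apply: (Clim_ext (fun t => f t i * \big[Cmult/RtoC 1]_(j <- r | P j) f t j)).
    by move=> t; rewrite big_cons Pi.
  by apply: Clim_mult => //; apply: H.
apply: (Clim_ext (fun t => \big[Cmult/RtoC 1]_(j <- r | P j) f t j)) => // t.
by rewrite big_cons Pi.
Qed.

Lemma Cmod_prod_bounded {I J : Type} (r : seq I) (P : pred I) (f : J -> I -> C) :
  (forall i, P i -> exists K : R, forall j, (Cmod (f j i) <= K)%R) ->
  exists K : R, forall j, (Cmod (\big[Cmult/RtoC 1]_(i <- r | P i) f j i) <= K)%R.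
Proof.
move=> H; elim: r => [|i r [K HK]].
  by exists 1%R => j; rewrite big_nil Cmod_1; lra.
case Pi: (P i); last by exists K => j; rewrite big_cons Pi.
have [K' HK'] := H i Pi; exists (K' * K)%R => j; rewrite big_cons Pi Cmod_mult.
by apply: Rmult_le_compat => //; apply: Cmod_ge_0.
Qed.

Lemma is_series_Clim_big (a : nat -> C) (l : C) :
  is_series a l -> Clim eventually (fun N => \big[Cplus/RtoC 0]_(0 <= n < N.+1) a n) l.
Proof. by move/is_series_Clim; apply: Clim_ext => N; apply: sum_n_big. Qed.

Theorem proposition1 (M : nat) (hM : (1 <= M)%N)
  (sq : C -> C) (hsq : forall w : C, sq w ^ 2 = w)
  (theta : 'I_M -> R) (a x : 'I_M -> C)
  (htheta : forall i : 'I_M, (Rabs (theta i) <= PI)%R)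
  (hx : forall i : 'I_M, x i <> 0)
  (hne : forall i j : 'I_M, i <> j -> forall n k : nat,
     (1 <= n)%N -> (1 <= k)%N ->
     x i ^ 2 * INR n ^ 2 - x j ^ 2 * INR k ^ 2 <> a j ^ 2 - a i ^ 2)
  (hIm : forall i j : 'I_M, i <> j -> Im (x i / x j) <> 0%R \/ x i = x j)
  (t : C)
  (ht : forall (i : 'I_M) (n : nat), (1 <= n)%N ->
     t ^ 2 <> a i ^ 2 + x i ^ 2 * INR n ^ 2) :
  exists s : 'I_M -> C,
    (forall i : 'I_M,
       is_series (fun n : nat => term M sq theta a x t i n.+1) (s i)) /\
    \big[Cplus/RtoC 0]_(i < M) s i
      = \big[Cmult/RtoC 1]_(i < M)
          brace (theta i) (x i) (sq (t ^ 2 - a i ^ 2)).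
Proof.
pose mu i n := x i ^ 2 * INR n.+1 ^ 2 + a i ^ 2.
pose c i n := cos_coef (theta i) n : C.
pose F N i z := \big[Cplus/RtoC 0]_(0 <= n < N) (c i n / (mu i n - z)).
have mu_t i n : mu i n <> t ^ 2.
  by move=> E; apply: (ht i n.+1) => //; rewrite -E /mu; ring.
have mu_mu i j n m : i != j -> mu i n <> mu j m.
  move/eqP => ij E; apply: (hne i j ij n.+1 m.+1) => //.
  rewrite (_ : a j ^ 2 - a i ^ 2 = (mu j m - x j ^ 2 * INR m.+1 ^ 2) - a i ^ 2);
    last by rewrite /mu; ring.
  by rewrite -E /mu; ring.
have Flim i z : (forall n, mu i n <> z) ->
    Clim eventually (fun N => F N.+1 i z) (brace (theta i) (x i) (sq (z - a i ^ 2))).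
  move=> Hz; apply: is_series_Clim_big.
  apply: is_series_C_ext (brace_series sq hsq (theta i) (x i) (z - a i ^ 2) (htheta i) (hx i) _) => //.
    by move=> n; rewrite /c /mu; congr (_ / _); ring.
  move=> n E; apply: (Hz n); rewrite /mu.
  by rewrite (_ : z = z - a i ^ 2 + a i ^ 2 + (x i ^ 2 * INR n.+1 ^ 2 - (z - a i ^ 2)));
    [ring | rewrite E; ring].
(* The bound must hold for all truncations and all poles at once; it supplies the majorant for the
   dominated convergence below. *)
have Fbound i j : j != i -> exists K : R, forall Nn : nat * nat,
    (Cmod (F Nn.1 j (mu i Nn.2)) <= K)%R.
  move=> ji; have [ec [eN [ec0 Hsep]]] : exists (e : R) (N : nat), (0 < e)%R /\
      forall n m : nat, (N <= n)%N || (N <= m)%N ->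
      (e * (1 + (INR m - INR n) ^ 2) <= Cmod (x j ^ 2 * INR m.+1 ^ 2
         - (x i ^ 2 * INR n.+1 ^ 2 + (a i ^ 2 - a j ^ 2))))%R.
    apply: shifted_squares_separated => //.
    have ij : i <> j by apply/eqP; rewrite eq_sym.
    case: (hIm i j ij) => [|E]; [by left | right; split=> // Ea].
    (* If [x i = x j] and the squares of [a i] and [a j] agreed, then the separation hypothesis
       would fail at [n = k = 1]. *)
    apply: (hne i j ij 1%N 1%N) => //; rewrite E.
    by rewrite (_ : a j ^ 2 - a i ^ 2 = - (a i ^ 2 - a j ^ 2)); [rewrite Ea; ring | ring].
  have [K [HK HS]] := sep_inv_bound _ _ _ ec0 Hsep.
  exists K => -[N n] /=; apply: Rle_trans (HS n N); apply: Rle_trans (Cmod_sum_le _ _) _.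
  apply: sum_R_le => m; rewrite Cmod_mult Cmod_R.
  rewrite (_ : mu j m - mu i n = x j ^ 2 * INR m.+1 ^ 2
     - (x i ^ 2 * INR n.+1 ^ 2 + (a i ^ 2 - a j ^ 2))); last by rewrite /mu; ring.
  rewrite -[X in (_ <= X)%R]Rmult_1_l.
  by apply: Rmult_le_compat_r; [exact: Cmod_ge_0 | exact: Rabs_cos_coef_le1].
(* The summand of [term] with every other factor truncated at [N]. Below, the outer sum stops at the
   same [N], as the finite identity demands. *)
pose G N i n := c i n / (mu i n - t ^ 2) * \big[Cmult/RtoC 1]_(j < M | j != i) F N j (mu i n).
have Hs i : exists s : C, is_series (fun n : nat => term M sq theta a x t i n.+1) s /\
    Clim eventually (fun N => \big[Cplus/RtoC 0]_(0 <= n < N.+1) G N.+1 i n) s.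
  have [B [HB Hmu]] := shifted_square_inv_bound (x i) (a i ^ 2 - t ^ 2) (hx i).
  have [K HK] := Cmod_prod_bounded (index_enum 'I_M) (fun j => j != i)
    (fun Nn j => F Nn.1 j (mu i Nn.2)) (Fbound i).
  apply: (tannery (fun N n => if (n < N.+1)%N then G N.+1 i n else 0) _
    (fun n => B * K * quad_decay (INR n))%R).
  - move=> n; apply: (Clim_ext_loc (fun N => G N.+1 i n)).
      by exists n => N /leP Hn; rewrite ltnS Hn.
    rewrite /term subn1 -RtoC_mult; apply: Clim_mult.
      rewrite (_ : x i ^ 2 * INR n.+1 ^ 2 + a i ^ 2 = mu i n) //.
      exact: Clim_const.
    by apply: Clim_prod => j ji; apply: Flim => m; apply: mu_mu.
  - exact: (ex_series_scal_l (V := R_NormedModule)) ex_series_quad_decay.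
  - apply: filter_forall => N n.
    have K0 : (0 <= K)%R by apply: Rle_trans (Cmod_ge_0 _) (HK (N, n)).
    have Q0 := quad_decay_pos (INR n).
    case: ifP => _; last by rewrite Cmod_0; apply: Rmult_le_pos; nra.
    rewrite Cmod_mult (_ : (B * K * _)%R = (B * quad_decay (INR n) * K)%R); last by ring.
    apply: Rmult_le_compat; [exact: Cmod_ge_0 | exact: Cmod_ge_0 | | exact: (HK (N.+1, n))].
    rewrite Cmod_mult Cmod_R.
    rewrite (_ : mu i n - t ^ 2 = x i ^ 2 * INR n.+1 ^ 2 + (a i ^ 2 - t ^ 2));
      last by rewrite /mu; ring.
    apply: Rle_trans (Hmu n); rewrite -[X in (_ <= X)%R]Rmult_1_l.
    by apply: Rmult_le_compat_r; [exact: Cmod_ge_0 | exact: Rabs_cos_coef_le1].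
  - by apply: filter_forall => N; apply: is_series_finite.
have [s Hss] := fin_all_exists Hs.
exists s; split=> [i|]; first exact: (proj1 (Hss i)).
have Hsum : Clim eventually (fun N => \big[Cplus/RtoC 0]_(i < M) \big[Cplus/RtoC 0]_(0 <= n < N.+1) G N.+1 i n)
    (\big[Cplus/RtoC 0]_(i < M) s i).
  by apply: Clim_sum => i; exact: (proj2 (Hss i)).
have Hprod : Clim eventually (fun N => \big[Cmult/RtoC 1]_(i < M) F N.+1 i (t ^ 2))
    (\big[Cmult/RtoC 1]_(i < M) brace (theta i) (x i) (sq (t ^ 2 - a i ^ 2))).
  by apply: Clim_prod => i _; apply: Flim.
(* For each [N] the truncated sum equals the truncated product by partial fractions, so both limits
   coincide. *)
apply: Clim_unique Hsum _; apply: Clim_ext Hprod => N.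
apply: prod_simple_fractions => //; first exact: index_enum_uniq.
  (* The index list is nonempty because [1 <= M]; an empty list would compare the product [1] with
     the sum [0]. *)
  apply/eqP => /(congr1 (fun r => Ordinal hM \in r)).
  by rewrite mem_index_enum.
by move=> i j n m _ _; apply: mu_mu.
Qed.
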